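(* Let $\sigma$ be a super-automorphism of $\mathcal{B}$. (i) There exist $\mu \in \Bbbk^\times$ and $s(z) \in \Bbbk[z]$ such that $\sigma = \sigma_{s,\mu}$. (ii) The group $\operatorname{Aut}_{\mathrm{super}}\mathcal{B}$ of superalgebra automorphisms of $\mathcal{B}$ is isomorphic to the semidirect product $N \rtimes K$, where $K \simeq \Bbbk^\times$ acts on $N \simeq \Bbbk[z]$ (additive group) by $\mu \cdot s(z) = s(\mu^2 z)$; concretely, the isomorphism $N \rtimes K \to \operatorname{Aut}_{\mathrm{super}} \mathcal{B}$ is given by $(s,\mu) \mapsto \sigma_{\mu s, \mu}$ for $s \in \Bbbk[z]$, $\mu \in \Bbbk^\times$. Thus, under this isomorphism, $N$ corresponds to $\{\sigma_{s,1} : s \in \Bbbk[z]\}$ and $K$ corresponds to $\{\sigma_{0,\mu} : \mu \in \Bbbk^\times\}$. (iii) Writing $\sigma = \sigma_{s,\mu}$, the restriction of $\sigma$ to $\mathcal{B}_0$ is given by $$\sigma(z) = \mu^2 z, \qquad \sigma(y^2) = \mu^2 y^2 + \mu z s(z), \qquad \sigma(xy) = \mu^2 xy.$$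
   Context: Let $\Bbbk$ be a (commutative) field of characteristic $p \neq 2$ ($p=0$ is allowed). The super Jordan plane $\mathcal{B}$ is the associative unital $\Bbbk$-algebra presented by generators $x, y$ with defining relations $x^2 = 0$ and $yz - zy - xz = 0$, where $z = xy + yx$. The relations are homogeneous for $\deg x = \deg y = 1$, so $\mathcal{B}$ is $\mathbb{Z}$-graded, and it is a superalgebra ($\mathbb{Z}/2\mathbb{Z}$-graded algebra) $\mathcal{B} = \mathcal{B}_0 \oplus \mathcal{B}_1$, where $\mathcal{B}_0$ (respectively $\mathcal{B}_1$) is the sum of the components of even (respectively odd) degree. The algebra $\mathcal{B}_0$ is generated by $z$, $y^2$ and $xy$. A super-automorphism of $\mathcal{B}$ is a $\Bbbk$-algebra automorphism $\sigma$ of $\mathcal{B}$ with $\sigma(\mathcal{B}_i) = \mathcal{B}_i$ for $i = 0, 1$; $\operatorname{Aut}_{\mathrm{super}}\mathcal{B}$ is the group of these under composition. The subalgebra of $\mathcal{B}$ generated by $z$ is a polynomial algebra $\Bbbk[z]$. For $\mu \in \Bbbk^\times$ and $s = s(z) \in \Bbbk[z]$, $\sigma_{s,\mu}$ denotes the unique super-automorphism of $\mathcal{B}$ such that $\sigma_{s,\mu}(x) = \mu x$ and $\sigma_{s,\mu}(y) = \mu y + s(z)x$. *)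

(* Defs.v *)
From HB Require Import structures.
From mathcomp Require Import all_boot all_algebra.
From mathcomp Require Import boolp classical_sets.
From mathcomp Require Import finmap.
From mathcomp.multinomials Require Import monalg.

Set Implicit Arguments.
Unset Strict Implicit.
Unset Printing Implicit Defensive.

Import GRing.Theory.
Local Open Scope ring_scope.

(* The algebra of the free monoid on two letters, with [false] standing for
   the generator x and [true] for y.  The library only provides its left
   algebra structure. *)
Definition freeAlg (k : fieldType) : Type := {malg k[{fmonom bool}]}.

Section FreeAlg.
Variable k : fieldType.

HB.instance Definition _ :=
  GRing.Lalgebra.copy (freeAlg k) {malg k[{fmonom bool}]}.

Fact malg_scalerAr (c : k) (f g : {malg k[{fmonom bool}]}) :
  c *: (f * g) = f * (c *: g).
Proof.
have comm_malgC (h : {malg k[{fmonom bool}]}) : c%:MP * h = h * c%:MP.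
  rewrite !malgM_def fgmulUg fgmulgU; apply: eq_bigr => w _.
  by rewrite mulrC mul1m mulm1.
by rewrite -!mul_malgC mulrA comm_malgC -mulrA.
Qed.

Fact freeAlg_scalerAr (c : k) (f g : freeAlg k) : c *: (f * g) = f * (c *: g).
Proof. exact: malg_scalerAr. Qed.

HB.instance Definition _ :=
  GRing.Lalgebra_isAlgebra.Build k (freeAlg k) freeAlg_scalerAr.

Definition freeX : freeAlg k := << fmu false >>.
Definition freeY : freeAlg k := << fmu true >>.
Definition freeZ : freeAlg k := freeX * freeY + freeY * freeX.

End FreeAlg.

(* The two-sided ideal generated by [S]. *)
Inductive genIdeal (A : nzRingType) (S : A -> Prop) : A -> Prop :=
| genIdeal_base a of S a : genIdeal S a
| genIdeal0 : genIdeal S 0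
| genIdealD a b of genIdeal S a & genIdeal S b : genIdeal S (a + b)
| genIdealMl c a of genIdeal S a : genIdeal S (c * a)
| genIdealMr c a of genIdeal S a : genIdeal S (a * c).

Lemma genIdealBM (A : nzRingType) (S : A -> Prop) (a a' b b' : A) :
  genIdeal S (a - a') -> genIdeal S (b - b') -> genIdeal S (a * b - a' * b').
Proof.
move=> Ia Ib; rewrite -(subrKA (a' * b)) -mulrBl -mulrBr.
by apply: genIdealD; [apply: genIdealMr | apply: genIdealMl].
Qed.

Lemma genIdealBZ (k : nzRingType) (A : lalgType k) (S : A -> Prop) (c : k) (a b : A) :
  genIdeal S (a - b) -> genIdeal S (c *: a - c *: b).
Proof. by rewrite -scalerBr -mulr_algl; apply: genIdealMl. Qed.

Variant sjpRel (k : fieldType) : freeAlg k -> Prop :=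
| sjpRel_xx : sjpRel (freeX k ^+ 2)
| sjpRel_yz :
    sjpRel (freeY k * freeZ k - freeZ k * freeY k - freeX k * freeZ k).

Definition sjpIdeal (k : fieldType) : {pred freeAlg k} :=
  fun f => `[< genIdeal (@sjpRel k) f >].

Fact sjpIdeal_zmod_closed (k : fieldType) : zmod_closed (@sjpIdeal k).
Proof.
split; first exact/asboolP/genIdeal0.
move=> a b /asboolP Ia /asboolP Ib; apply/asboolP/genIdealD => //.
by rewrite -mulN1r; apply: genIdealMl.
Qed.

HB.instance Definition _ (k : fieldType) :=
  GRing.isZmodClosed.Build (freeAlg k) (@sjpIdeal k) (@sjpIdeal_zmod_closed k).

(* The super Jordan plane.  The library builds the quotient of an additive
   group by a subgroup, but multiplies only in the commutative case. *)
Definition sjp (k : fieldType) : Type := {ideal_quot @sjpIdeal k}.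

Section SuperJordanPlane.
Variable k : fieldType.
Notation F := (freeAlg k).
Notation B := (sjp k).
Local Open Scope quotient_scope.

HB.instance Definition _ := GRing.Zmodule.on B.
HB.instance Definition _ := Quotient.on B.

Definition sjp_pi (f : F) : B := \pi_B f.

Lemma sjp_piP (f g : F) : sjp_pi f = sjp_pi g <-> genIdeal (@sjpRel k) (f - g).
Proof.
rewrite /sjp_pi; split.
  by move/eqP; rewrite -Quotient.idealrBE => /asboolP.
by move=> I; apply/eqP; rewrite -Quotient.idealrBE; apply/asboolP.
Qed.

Lemma sjp_piK (b : B) : sjp_pi (repr b) = b.
Proof. exact: reprK. Qed.

Lemma sjp_ind (P : B -> Prop) : (forall f, P (sjp_pi f)) -> forall b, P b.
Proof. by move=> h b; rewrite -[b]sjp_piK. Qed.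

Lemma sjp_piD (f g : F) : sjp_pi (f + g) = sjp_pi f + sjp_pi g.
Proof. by rewrite /sjp_pi !piE. Qed.

Definition sjp_one : B := sjp_pi 1.
Definition sjp_mul (a b : B) : B := sjp_pi (repr a * repr b).
Definition sjp_scale (c : k) (a : B) : B := sjp_pi (c *: repr a).

Lemma sjp_piM (f g : F) : sjp_pi (f * g) = sjp_mul (sjp_pi f) (sjp_pi g).
Proof.
apply/sjp_piP.
have /sjp_piP If : sjp_pi f = sjp_pi (repr (sjp_pi f)) by rewrite sjp_piK.
have /sjp_piP Ig : sjp_pi g = sjp_pi (repr (sjp_pi g)) by rewrite sjp_piK.
exact: genIdealBM.
Qed.

Lemma sjp_piZ (c : k) (f : F) : sjp_pi (c *: f) = sjp_scale c (sjp_pi f).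
Proof.
by apply/sjp_piP/genIdealBZ/sjp_piP; rewrite sjp_piK.
Qed.

Fact sjp_mulA : associative sjp_mul.
Proof.
by elim/sjp_ind=> f; elim/sjp_ind=> g; elim/sjp_ind=> h; rewrite -!sjp_piM mulrA.
Qed.

Fact sjp_mul1r : left_id sjp_one sjp_mul.
Proof. by elim/sjp_ind=> f; rewrite -sjp_piM mul1r. Qed.

Fact sjp_mulr1 : right_id sjp_one sjp_mul.
Proof. by elim/sjp_ind=> f; rewrite -sjp_piM mulr1. Qed.

Fact sjp_mulDl : left_distributive sjp_mul +%R.
Proof.
elim/sjp_ind=> f; elim/sjp_ind=> g; elim/sjp_ind=> h.
by rewrite -sjp_piD -!sjp_piM -sjp_piD mulrDl.
Qed.

Fact sjp_mulDr : right_distributive sjp_mul +%R.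
Proof.
elim/sjp_ind=> f; elim/sjp_ind=> g; elim/sjp_ind=> h.
by rewrite -sjp_piD -!sjp_piM -sjp_piD mulrDr.
Qed.

Fact sjp_oner_neq0 : sjp_one != 0.
Proof.
apply/eqP; rewrite (_ : 0 = sjp_pi 0); last by rewrite /sjp_pi piE.
move/sjp_piP; rewrite subr0 => I1.
pose eps : {rmorphism {malg k[{fmonom bool}]} -> k} := mcoeff (mone : {fmonom bool}).
have epsU i : eps << fmu i >> = 0.
  by rewrite /eps /= mcoeffU1 -fdeg_eq0 fdegU.
have epsB0 (f g : F) : eps f = 0 -> eps g = 0 -> eps (f - g) = 0.
  by move=> ef eg; rewrite (rmorphB eps f g : eps (f - g) = _) ef eg subrr.
have epsD0 (f g : F) : eps f = 0 -> eps g = 0 -> eps (f + g) = 0.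
  by move=> ef eg; rewrite (rmorphD eps f g : eps (f + g) = _) ef eg addr0.
have epsM0 (f g : F) : eps f = 0 -> eps (f * g) = 0.
  by move=> ef; rewrite (rmorphM eps f g : eps (f * g) = _) ef mul0r.
have eps0M (f g : F) : eps g = 0 -> eps (f * g) = 0.
  by move=> eg; rewrite (rmorphM eps f g : eps (f * g) = _) eg mulr0.
suff eps1 : eps (1 : F) = 0.
  by have := oner_neq0 k; rewrite -(rmorph1 eps) eps1 eqxx.
elim: I1 => [f [] | | f g _ ef _ eg | f g _ eg | f g _ ef].
- exact: epsM0 (epsU _).
- apply: (epsB0); last exact: epsM0 (epsU _).
  by apply: (epsB0); [apply: epsM0 | apply: eps0M]; apply: epsU.
- exact: (raddf0 eps).
- exact: epsD0.
- exact: eps0M.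
- exact: epsM0.
Qed.

HB.instance Definition _ := GRing.Zmodule_isNzRing.Build B
  sjp_mulA sjp_mul1r sjp_mulr1 sjp_mulDl sjp_mulDr sjp_oner_neq0.

Fact sjp_scalerA a b (v : B) : sjp_scale a (sjp_scale b v) = sjp_scale (a * b) v.
Proof. by elim/sjp_ind: v => f; rewrite -!sjp_piZ scalerA. Qed.

Fact sjp_scale1r : left_id 1 sjp_scale.
Proof. by elim/sjp_ind=> f; rewrite -sjp_piZ scale1r. Qed.

Fact sjp_scalerDr : right_distributive sjp_scale +%R.
Proof.
move=> c; elim/sjp_ind=> f; elim/sjp_ind=> g.
by rewrite -sjp_piD -!sjp_piZ -sjp_piD scalerDr.
Qed.

Fact sjp_scalerDl (v : B) : {morph sjp_scale^~ v : a b / a + b}.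
Proof.
by move=> a b; elim/sjp_ind: v => f; rewrite -!sjp_piZ -sjp_piD scalerDl.
Qed.

HB.instance Definition _ := GRing.Zmodule_isLmodule.Build k B
  sjp_scalerA sjp_scale1r sjp_scalerDr sjp_scalerDl.

Fact sjp_scalerAl (c : k) (u v : B) :
  sjp_scale c (sjp_mul u v) = sjp_mul (sjp_scale c u) v.
Proof.
elim/sjp_ind: u => f; elim/sjp_ind: v => g.
by rewrite -sjp_piM -!sjp_piZ -sjp_piM scalerAl.
Qed.

HB.instance Definition _ := GRing.Lmodule_isLalgebra.Build k B sjp_scalerAl.

Fact sjp_scalerAr (c : k) (u v : B) :
  sjp_scale c (sjp_mul u v) = sjp_mul u (sjp_scale c v).
Proof.
elim/sjp_ind: u => f; elim/sjp_ind: v => g.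
by rewrite -sjp_piM -!sjp_piZ -sjp_piM scalerAr.
Qed.

HB.instance Definition _ := GRing.Lalgebra_isAlgebra.Build k B sjp_scalerAr.

Fact sjp_pi_is_linear : linear sjp_pi.
Proof. by move=> c f g; rewrite sjp_piD sjp_piZ. Qed.

Fact sjp_pi_is_monoid_morphism : monoid_morphism sjp_pi.
Proof. exact: (conj erefl sjp_piM). Qed.

HB.instance Definition _ := GRing.isLinear.Build k F B _ sjp_pi sjp_pi_is_linear.
HB.instance Definition _ :=
  GRing.isMonoidMorphism.Build F B sjp_pi sjp_pi_is_monoid_morphism.

Definition sjpX : B := sjp_pi (freeX k).
Definition sjpY : B := sjp_pi (freeY k).
Definition sjpZ : B := sjpX * sjpY + sjpY * sjpX.

Lemma sjp_pi_eq0 (f : F) : genIdeal (@sjpRel k) f -> sjp_pi f = 0.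
Proof. by move=> If; rewrite -(rmorph0 sjp_pi); apply/sjp_piP; rewrite subr0. Qed.

Lemma sjp_relXX : sjpX ^+ 2 = 0.
Proof.
rewrite -(rmorphXn sjp_pi); exact/sjp_pi_eq0/genIdeal_base/sjpRel_xx.
Qed.

Lemma sjp_relYZ : sjpY * sjpZ - sjpZ * sjpY - sjpX * sjpZ = 0.
Proof.
have piM (f g : F) : sjp_pi f * sjp_pi g = sjp_pi (f * g) by rewrite rmorphM.
have piD (f g : F) : sjp_pi f + sjp_pi g = sjp_pi (f + g) by rewrite rmorphD.
have piB (f g : F) : sjp_pi f - sjp_pi g = sjp_pi (f - g) by rewrite rmorphB.
have -> : sjpZ = sjp_pi (freeZ k) by rewrite /sjpZ !piM piD.
rewrite (piM (freeY k)) (piM (freeZ k)) (piM (freeX k)) piB piB.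
exact/sjp_pi_eq0/genIdeal_base/sjpRel_yz.
Qed.

(* The component [B_i] of the superalgebra, where [i = false] means even:
   the span of the classes of the words whose length has parity [i]. *)
Definition sjpHomog (i : bool) : set B :=
  [set sjp_pi f | f in
     [set f : F | forall w, w \in msupp f -> odd (fdeg w) = i]]%classic.

Definition isSuperAut (f : B -> B) : Prop :=
  [/\ linear f, monoid_morphism f, bijective f &
      forall i, (f @` sjpHomog i = sjpHomog i)%classic].

Definition superAut : Type := {f : B -> B | `[< isSuperAut f >]}.

HB.instance Definition _ := Choice.on superAut.

Definition superAut_fun (s : superAut) : B -> B := val s.

End SuperJordanPlane.

Coercion superAut_fun : superAut >-> Funclass.

Section SuperAut.
Variable k : fieldType.
Notation F := (freeAlg k).
Notation B := (sjp k).
Implicit Types s t : superAut k.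

Lemma superAutP s : isSuperAut s.
Proof. exact: asboolW (valP s). Qed.

Definition SuperAut (f : B -> B) (fP : isSuperAut f) : superAut k :=
  exist _ f (asboolT fP).

HB.instance Definition _ s := GRing.isLinear.Build k B B _ (superAut_fun s)
  (let: And4 h _ _ _ := superAutP s in h).
HB.instance Definition _ s := GRing.isMonoidMorphism.Build B B (superAut_fun s)
  (let: And4 _ h _ _ := superAutP s in h).

Lemma superAut_ext s t : s =1 t -> s = t.
Proof. by move=> st; apply/val_inj/funext. Qed.

Lemma superAut_eqP s t :
  s (sjpX k) = t (sjpX k) -> s (sjpY k) = t (sjpY k) -> s = t.
Proof.
move=> eqX eqY; apply: superAut_ext; elim/sjp_ind => f.
have eqU w : s (sjp_pi (<< w >> : F)) = t (sjp_pi (<< w >> : F)).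
  case: w; elim=> [|i w IHw].
    by rewrite (_ : << _ >> = 1 :> F) ?rmorph1 // -fmoneE.
  have -> : << FMonom (i :: w) >> = << fmu i >> * << FMonom w >> :> F.
    by rewrite [RHS]fgmulUU mulr1 /mmul /= fmmulE fmuE.
  by rewrite !rmorphM /= IHw; congr (_ * _); case: i.
rewrite [f : {malg k[{fmonom bool}]}]monalgE.
rewrite (_ : \sum_(w <- _) _ = \sum_(w <- msupp f) (f@_w *: (<< w >> : F))).
  by rewrite !linear_sum; apply: eq_bigr => w _; rewrite !linearZ /= eqU.
apply: eq_bigr => w _; apply/malgP => u.
by rewrite mcoeffZ !mcoeffU mulr_natr.
Qed.

Fact superAut1_subproof : isSuperAut (@id B).
Proof.
split=> //; first exact: inv_bij.
by move=> i; rewrite image_id.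
Qed.

Fact superAutM_subproof s t : isSuperAut (s \o t).
Proof.
have [_ _ bs hs] := superAutP s; have [_ _ bt ht] := superAutP t.
split; first by move=> c a b /=; rewrite !linearP.
- by split=> [|a b] /=; rewrite ?rmorph1 ?rmorphM.
- exact: bij_comp.
by move=> i; rewrite -image_comp ht hs.
Qed.

Fact superAut_surj s b : exists a, s a == b.
Proof. by have [_ _ [g _ gK] _] := superAutP s; exists (g b); rewrite gK. Qed.

Definition superAut_inv s (b : B) : B := xchoose (superAut_surj s b).

Lemma superAut_invK s : cancel (superAut_inv s) s.
Proof. by move=> b; apply/eqP/(xchooseP (superAut_surj s b)). Qed.

Lemma superAutK s : cancel s (superAut_inv s).
Proof.
have [_ _ /bij_inj injs _] := superAutP s.
by move=> b; apply: injs; rewrite superAut_invK.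
Qed.

Fact superAutV_subproof s : isSuperAut (superAut_inv s).
Proof.
have [_ _ /bij_inj injs hs] := superAutP s; have sK := superAut_invK s.
split.
- by move=> c a b; apply: injs; rewrite sK linearP /= !sK.
- split=> [|a b]; apply: injs; first by rewrite sK rmorph1.
  by rewrite rmorphM /= !sK.
- by exists s; [exact: superAut_invK | exact: superAutK].
move=> i; rewrite -{1}hs image_comp -[RHS]image_id.
by apply: eq_imagel => b _ /=; rewrite superAutK.
Qed.

(* The product of the group is composition: [(s * t) b = s (t b)]. *)
Definition superAut_one := SuperAut superAut1_subproof.
Definition superAut_mul s t := SuperAut (superAutM_subproof s t).
Definition superAut_invg s := SuperAut (superAutV_subproof s).

Fact superAut_mulA : associative superAut_mul.
Proof. by move=> s t u; apply: superAut_ext. Qed.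
Fact superAut_mul1 : left_id superAut_one superAut_mul.
Proof. by move=> s; apply: superAut_ext. Qed.
Fact superAut_mulr1 : right_id superAut_one superAut_mul.
Proof. by move=> s; apply: superAut_ext. Qed.
Fact superAut_mulV : left_inverse superAut_one superAut_invg superAut_mul.
Proof. by move=> s; apply: superAut_ext => b; apply: superAutK. Qed.
Fact superAut_mulrV : right_inverse superAut_one superAut_invg superAut_mul.
Proof. by move=> s; apply: superAut_ext => b; apply: superAut_invK. Qed.


HB.instance Definition _ := isGroup.Build (superAut k)
  superAut_mulA superAut_mul1 superAut_mulr1 superAut_mulV superAut_mulrV.

(* [isSigma s mu] characterises the super-automorphism sigma_{s,mu}; it is
   unique by [superAut_eqP]. *)
Definition isSigma (s : {poly k}) (mu : k) (f : superAut k) : Prop :=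
  f (sjpX k) = mu *: sjpX k /\
  f (sjpY k) = mu *: sjpY k + horner_alg (sjpZ k) s * sjpX k.

Lemma isSigma_uniq (s : {poly k}) (mu : k) (f g : superAut k) :
  isSigma s mu f -> isSigma s mu g -> f = g.
Proof. by move=> [fX fY] [gX gY]; apply: superAut_eqP; rewrite ?fX ?fY. Qed.

End SuperAut.

(* The multiplicative group of a field; the library's [{unit R}] is only
   available for finite rings. *)
Definition fieldUnits (k : fieldType) : Type := {c : k | c != 0}.

HB.instance Definition _ (k : fieldType) := Choice.on (fieldUnits k).

Definition fieldUnits_val (k : fieldType) (c : fieldUnits k) : k := val c.
Coercion fieldUnits_val : fieldUnits >-> GRing.Field.sort.

Section FieldUnits.
Variable k : fieldType.
Implicit Types a b c : fieldUnits k.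

Definition fieldUnits_one : fieldUnits k := exist _ 1 (oner_neq0 k).
Definition fieldUnits_mul a b : fieldUnits k :=
  exist _ (val a * val b) (mulf_neq0 (valP a) (valP b)).
Definition fieldUnits_inv a : fieldUnits k :=
  exist _ (val a)^-1 (invr_neq0 (valP a)).

Fact fieldUnits_mulA : associative fieldUnits_mul.
Proof. by move=> a b c; apply/val_inj/mulrA. Qed.
Fact fieldUnits_mul1 : left_id fieldUnits_one fieldUnits_mul.
Proof. by move=> a; apply/val_inj/mul1r. Qed.
Fact fieldUnits_mulr1 : right_id fieldUnits_one fieldUnits_mul.
Proof. by move=> a; apply/val_inj/mulr1. Qed.
Fact fieldUnits_mulV : left_inverse fieldUnits_one fieldUnits_inv fieldUnits_mul.
Proof. by move=> a; apply/val_inj/mulVf/(valP a). Qed.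
Fact fieldUnits_mulrV : right_inverse fieldUnits_one fieldUnits_inv fieldUnits_mul.
Proof. by move=> a; apply/val_inj/mulfV/(valP a). Qed.

HB.instance Definition _ := isGroup.Build (fieldUnits k)
  fieldUnits_mulA fieldUnits_mul1 fieldUnits_mulr1 fieldUnits_mulV fieldUnits_mulrV.

End FieldUnits.

(* Actions of a group on an additive group by automorphisms, and the
   corresponding semidirect product N x| K. *)
Record groupAct (N : zmodType) (K : groupType) := GroupAct {
  gact :> K -> N -> N;
  gact1 : forall s, gact 1%g s = s;
  gactM : forall a b s, gact (a * b)%g s = gact a (gact b s);
  gactD : forall a s t, gact a (s + t) = gact a s + gact a t
}.

Definition semidirect (N : zmodType) (K : groupType) (act : groupAct N K) : Type :=
  (N * K)%type.

HB.instance Definition _ N K (act : groupAct N K) := Choice.on (semidirect act).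

Section Semidirect.
Variables (N : zmodType) (K : groupType) (act : groupAct N K).
Implicit Types u v w : semidirect act.

Lemma gact0 a : act a 0 = 0.
Proof. by apply: (addIr (act a 0)); rewrite -gactD !add0r. Qed.

Lemma gactN a s : act a (- s) = - act a s.
Proof. by apply: (addIr (act a s)); rewrite -gactD !addNr gact0. Qed.

Definition semidirect_one : semidirect act := (0, 1%g).
Definition semidirect_mul u v : semidirect act :=
  (u.1 + act u.2 v.1, (u.2 * v.2)%g).
Definition semidirect_inv u : semidirect act :=
  (- act u.2^-1%g u.1, u.2^-1%g).

Fact semidirect_mulA : associative semidirect_mul.
Proof.
move=> [s a] [t b] [r c]; rewrite /semidirect_mul /=.
by rewrite gactD gactM addrA mulgA.
Qed.
Fact semidirect_mul1 : left_id semidirect_one semidirect_mul.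
Proof. by move=> [s a]; rewrite /semidirect_mul /= gact1 add0r mul1g. Qed.
Fact semidirect_mulr1 : right_id semidirect_one semidirect_mul.
Proof. by move=> [s a]; rewrite /semidirect_mul /= gact0 addr0 mulg1. Qed.
Fact semidirect_mulV : left_inverse semidirect_one semidirect_inv semidirect_mul.
Proof. by move=> [s a]; rewrite /semidirect_mul /= addNr mulVg. Qed.
Fact semidirect_mulrV : right_inverse semidirect_one semidirect_inv semidirect_mul.
Proof.
move=> [s a]; rewrite /semidirect_mul /= gactN -gactM mulgV gact1.
by rewrite addrN.
Qed.

HB.instance Definition _ := isGroup.Build (semidirect act)
  semidirect_mulA semidirect_mul1 semidirect_mulr1 semidirect_mulV semidirect_mulrV.

End Semidirect.

Section Dilation.
Variable k : fieldType.

Definition dilate (mu : fieldUnits k) (s : {poly k}) : {poly k} :=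
  s \Po ((mu : k) ^+ 2 *: 'X).

Fact dilate1 s : dilate 1%g s = s.
Proof. by rewrite /dilate expr1n scale1r comp_polyXr. Qed.

Fact dilateM mu nu s : dilate (mu * nu)%g s = dilate mu (dilate nu s).
Proof.
rewrite /dilate -comp_polyA comp_polyZ comp_polyX scalerA.
by rewrite -exprMn [X in X ^+ 2]mulrC.
Qed.

Fact dilateD mu s t : dilate mu (s + t) = dilate mu s + dilate mu t.
Proof. exact: comp_polyD. Qed.

Definition dilation : groupAct {poly k} (fieldUnits k) :=
  GroupAct dilate1 dilateM dilateD.

End Dilation.

(* Main.v *)
Require Import Defs.
From mathcomp Require Import all_boot all_algebra.
From mathcomp Require Import boolp classical_sets.
From HB Require Import structures.
From mathcomp Require Import finmap.
From mathcomp.multinomials Require Import monalg.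

Set Implicit Arguments.
Unset Strict Implicit.
Unset Printing Implicit Defensive.

Import GRing.Theory.
Local Open Scope ring_scope.
Local Open Scope classical_set_scope.

(** The super Jordan plane embeds in the two by two matrices over the Jordan
    plane J = k[w][t; w^2 d/dw], in which t w - w t = w^2, by
      x |-> [[0, w], [0, 0]]   and   y |-> [[0, t], [1, 0]].
    Then z and y^2 become the scalar matrices w and t, even elements are
    diagonal and odd elements antidiagonal.  The monomials x^a z^b y^c with
    a <= 1 span the algebra ([normal_form_muly]), and the matrix of a
    combination of them determines its coefficients ([rho_inj]), so the
    representation is faithful.  The ring J is a domain in which degrees in t
    add up ([size_skew_mul]).  In characteristic p the centralizer of w
    contains t^p, so all arguments below count degrees instead of using
    commutation with w.

    Let sigma be a super-automorphism.  Then sigma x is odd of square zero,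
    and since J is a domain such an element is x j or (y x y) j with j in the
    copy of J generated by z and y^2 ([odd_square_zero]).  The second shape is
    impossible: x would be of the form u (y x y) v, and the upper corners of u
    and v have no constant term, so they cannot be units
    ([x_neq_mul_yxy]).  Applying this to the inverse as well, sigma x = mu x
    ([image_x_scalar]).  The same comparison for y x y shows that the lower
    corner of sigma y is a scalar nu ([image_y_corner_scalar]).  As y^2 lies
    in the image of sigma, the upper corner b of sigma y and w generate t,
    which forces b to have degree at most one in t ([image_y_degree]).  The
    relation y z = z y + x z then leaves only b = mu t + w s(w) and nu = mu,
    that is, sigma y = mu y + s(z) x ([image_y_form]).

    Conversely these formulas respect the defining relations, so they define
    endomorphisms by the universal property ([sjp_universal]); the composition
    rule [twist_morph_comp] shows that they form a group isomorphic to the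
    semidirect product, and gives the inverses. *)

(** * Skew polynomial rings of a derivation *)

Record derivation (R : comNzRingType) := Derivation {
  der_fun :> R -> R;
  derD : forall a b, der_fun (a + b) = der_fun a + der_fun b;
  derM : forall a b, der_fun (a * b) = a * der_fun b + der_fun a * b
}.

Section SkewRing.
Variables (R : comNzRingType) (d : derivation R).
Implicit Types (f g h : {poly R}) (c : R).

Lemma der0 : d 0 = 0.
Proof. by apply: (addrI (d 0)); rewrite -derD !addr0. Qed.

Lemma der1 : d 1 = 0.
Proof. by have := derM d 1 1; rewrite !mul1r mulr1 -{1}[d 1]addr0 => /addrI. Qed.

(** Left multiplication by the variable of the ring R[t; d], where
t * c = c * t + d c and coefficients are written on the left. *)
Definition skewT g : {poly R} := g * 'X + \poly_(i < size g) d g`_i.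

Lemma coef_skewT g i : (skewT g)`_i = (g * 'X)`_i + d g`_i.
Proof.
rewrite coefD coef_poly; case: ltnP => // le_gi.
by rewrite [in RHS](nth_default _ le_gi) der0.
Qed.

Lemma skewTD : {morph skewT : g h / g + h}.
Proof.
move=> g h; apply/polyP => i.
by rewrite [RHS]coefD !coef_skewT !coefMX !coefD derD; case: i => [|i] /=;
   rewrite ?addr0 ?add0r // addrACA.
Qed.

Lemma skewT0 : skewT 0 = 0.
Proof. by apply: (addrI (skewT 0)); rewrite -skewTD !addr0. Qed.

Lemma skewTZ c g : skewT (c *: g) = c *: skewT g + d c *: g.
Proof.
apply/polyP => i.
rewrite [RHS]coefD !coefZ !coef_skewT !coefMX !coefZ derM mulrDr addrA.
by case: i => [|i] /=; rewrite ?mulr0.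
Qed.

Lemma skewT_sum n (F : 'I_n -> {poly R}) :
  skewT (\sum_(i < n) F i) = \sum_(i < n) skewT (F i).
Proof. exact: (big_morph _ skewTD skewT0). Qed.

Lemma iter_skewTD i : {morph iter i skewT : g h / g + h}.
Proof. by elim: i => // i IH g h /=; rewrite IH skewTD. Qed.

Lemma skewTC c : skewT c%:P = c *: 'X + (d c)%:P.
Proof.
apply/polyP => i; rewrite coef_skewT [RHS]coefD coefZ coefX coefMX !coefC.
by case: i => [|[|i]] /=; rewrite ?mulr0 ?mulr1 ?der0.
Qed.

Lemma skewT1 : skewT 1 = 'X.
Proof. by rewrite skewTC der1 scale1r addr0. Qed.

Lemma iter_skewT1 i : iter i skewT 1 = 'X^i.
Proof.
elim: i => [|i IH]; first by rewrite expr0.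
rewrite iterS IH; apply/polyP => j; rewrite coef_skewT -exprSr coefXn.
by case: eqP => _; rewrite coefXn; case: eqP; rewrite ?der0 ?der1 ?addr0.
Qed.

Definition skew_mul f g := \sum_(i < size f) f`_i *: iter i skewT g.

Lemma skew_mul_widen n f g :
  (size f <= n)%N -> skew_mul f g = \sum_(i < n) f`_i *: iter i skewT g.
Proof.
move=> le_fn; rewrite /skew_mul (big_ord_widen n (fun i => f`_i *: iter i skewT g)) //.
rewrite big_mkcond; apply: eq_bigr => i _.
by case: ltnP => // /(nth_default 0) ->; rewrite scale0r.
Qed.

Lemma skew_mulDl g : {morph skew_mul^~ g : f h / f + h}.
Proof.
move=> f h; pose n := maxn (size f) (size h).
rewrite !(@skew_mul_widen n) ?leq_maxl ?leq_maxr ?size_polyD //.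
by rewrite -big_split; apply: eq_bigr => i _; rewrite coefD scalerDl.
Qed.

Lemma skew_mulDr f : {morph skew_mul f : g h / g + h}.
Proof.
move=> g h; rewrite -big_split; apply: eq_bigr => i _ /=.
by rewrite iter_skewTD scalerDr.
Qed.

Lemma skew_mulCl c g : skew_mul c%:P g = c *: g.
Proof.
by rewrite (@skew_mul_widen 1) ?size_polyC ?leq_b1 // big_ord1 coefC.
Qed.

Lemma skew_mulMXl f g : skew_mul (f * 'X) g = skew_mul f (skewT g).
Proof.
rewrite (@skew_mul_widen (size f).+1).
  rewrite big_ord_recl coefMX scale0r add0r; apply: eq_bigr => i _.
  by rewrite lift0 coefMX iterSr.
by apply: leq_trans (size_polyMleq _ _) _; rewrite size_polyX addn2.
Qed.

Lemma skew_mulMXaddC f c g :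
  skew_mul (f * 'X + c%:P) g = skew_mul f (skewT g) + c *: g.
Proof. by rewrite skew_mulDl skew_mulMXl skew_mulCl. Qed.

Lemma skew_mulZl c f g : skew_mul (c *: f) g = c *: skew_mul f g.
Proof.
rewrite (@skew_mul_widen (size f)) ?size_scale_leq // scaler_sumr.
by apply: eq_bigr => i _; rewrite coefZ scalerA.
Qed.

Lemma skew_mulXl g : skew_mul 'X g = skewT g.
Proof. by rewrite -['X]mul1r skew_mulMXl skew_mulCl scale1r. Qed.

Lemma skew_mul0l g : skew_mul 0 g = 0.
Proof. by rewrite /skew_mul size_poly0 big_ord0. Qed.

Lemma skew_mul0r f : skew_mul f 0 = 0.
Proof. by apply: (addrI (skew_mul f 0)); rewrite -skew_mulDr !addr0. Qed.

Lemma skew_mul_sumX f n (F : 'I_n -> {poly R}) :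
  skew_mul (\sum_(i < n) F i) f = \sum_(i < n) skew_mul (F i) f.
Proof. exact: (big_morph (skew_mul^~ f) (skew_mulDl f) (skew_mul0l f)). Qed.

(** The product sends f to the operator that f defines on {poly R}; since
that operator is linear over R on the left, associativity only has to be
known for multiplication by the variable. *)
Lemma skew_mul_skewT g h : skew_mul (skewT g) h = skewT (skew_mul g h).
Proof.
rewrite /skewT skew_mulDl skew_mulMXl -/(skewT _) /skew_mul skewT_sum.
under [RHS]eq_bigr do rewrite skewTZ -iterS iterSr.
rewrite big_split; congr (_ + _).
rewrite -/(skew_mul _ h) (@skew_mul_widen (size g)) ?size_poly //.
by apply: eq_bigr => i _; rewrite coef_poly ltn_ord.
Qed.

Lemma skew_mulA : associative skew_mul.
Proof.
move=> f g h; rewrite [skew_mul f g]/skew_mul skew_mul_sumX.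
apply: eq_bigr => i _; rewrite skew_mulZl; congr (_ *: _).
by elim: (i : nat) => //= j IH; rewrite skew_mul_skewT IH.
Qed.

Lemma skew_mul1r : left_id 1 skew_mul.
Proof. by move=> f; rewrite skew_mulCl scale1r. Qed.

Lemma skew_mulr1 : right_id 1 skew_mul.
Proof.
move=> f; rewrite -[RHS]coefK poly_def.
by apply: eq_bigr => i _ /=; rewrite iter_skewT1.
Qed.

Lemma skew_mulXr f : skew_mul f 'X = f * 'X.
Proof.
rewrite -{2}[f]coefK poly_def mulr_suml; apply: eq_bigr => i _.
by rewrite -scalerAl -exprSr -iter_skewT1 iterSr skewT1.
Qed.

(** The derivation is a phantom parameter: it selects the ring structure put
on {poly R}. *)
Definition skewPoly of derivation R : Type := {poly R}.

HB.instance Definition _ := GRing.Zmodule.on (skewPoly d).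
HB.instance Definition _ := GRing.Zmodule_isNzRing.Build (skewPoly d)
  skew_mulA skew_mul1r skew_mulr1 (fun f h g => skew_mulDl g f h)
  skew_mulDr (oner_neq0 {poly R}).

End SkewRing.

Section SkewDomain.
Variables (R : idomainType) (d : derivation R).
Implicit Types (f g h : {poly R}) (c : R).

Lemma size_skewT g : g != 0 -> size (skewT d g) = (size g).+1.
Proof.
move=> nz_g; rewrite size_polyDl size_mulX //.
by rewrite ltnS size_poly.
Qed.

(** Moving t across a coefficient only creates terms of lower degree, so
degrees add up as in the commutative case. *)
Lemma size_skew_mul f g :
  f != 0 -> g != 0 -> size (skew_mul d f g) = (size f + size g).-1.
Proof.
elim/poly_ind: f g => [|f c IH] g; first by rewrite eqxx.
rewrite skew_mulMXaddC; have [->|nz_f] := eqVneq f 0.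
  rewrite mul0r add0r skew_mul0l add0r polyC_eq0 => nz_c _.
  by rewrite size_scale // size_polyC nz_c.
move=> _ nz_g; have nz_Tg : skewT d g != 0 by rewrite -size_poly_gt0 size_skewT.
have szT := IH _ nz_f nz_Tg; have f_gt0 : (0 < size f)%N by rewrite size_poly_gt0.
rewrite size_polyDl szT size_skewT // addnS /=; last first.
  by apply: leq_ltn_trans (size_scale_leq _ _) _; rewrite -{1}[size g]add0n ltn_add2r.
by rewrite size_MXaddC (negPf nz_f).
Qed.

Lemma skew_mul_eq0 f g : skew_mul d f g = 0 -> (f == 0) || (g == 0).
Proof.
move=> fg0; apply: contraT; rewrite negb_or => /andP[nz_f nz_g].
have := size_skew_mul nz_f nz_g; rewrite fg0 size_poly0.
by case: (size f) (size_poly_gt0 f) => [|[|n]]; case: (size g) (size_poly_gt0 g) => [|m];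
  rewrite ?nz_f ?nz_g ?addSn ?addnS.
Qed.

(** By degrees, a factor of a nonzero constant is a constant; this replaces
a study of the units and the ideals of the ring. *)
Lemma skew_mul_const f g c : c != 0 -> skew_mul d f g = c%:P ->
  exists a b, [/\ f = a%:P, g = b%:P & a * b = c].
Proof.
move=> nz_c fg; have nz_fg : skew_mul d f g != 0 by rewrite fg polyC_eq0.
have nz_f : f != 0 by apply: contraNneq nz_fg => ->; rewrite skew_mul0l.
have nz_g : g != 0.
  by apply: contraNneq nz_fg => ->; rewrite skew_mul0r.
have := size_skew_mul nz_f nz_g; rewrite fg size_polyC nz_c => sz.
have [sz_f sz_g] : (size f <= 1)%N /\ (size g <= 1)%N.
  move: nz_f nz_g sz; rewrite -!size_poly_gt0.
  by case: (size f) (size g) => [|[|m]] [|[|n]]; rewrite ?addSn ?addnS.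
exists f`_0, g`_0; split; [exact: size1_polyC | exact: size1_polyC |].
by move: fg; rewrite {1}(size1_polyC sz_f) {1}(size1_polyC sz_g) skew_mulCl
  -mul_polyC -polyCM => /polyC_inj.
Qed.

End SkewDomain.

(** * The universal property and the grading of the super Jordan plane *)

(** Stated in arbitrary rings so that the relation is transported in one
step. *)
Lemma morph_relYZ (R S : nzRingType) (e : R -> S) (u v : R) :
    {morph e : f g / f + g} -> {morph e : f g / f - g} ->
    {morph e : f g / f * g} ->
  e (v * (u * v + v * u) - (u * v + v * u) * v - u * (u * v + v * u)) =
  e v * (e u * e v + e v * e u) - (e u * e v + e v * e u) * e v
    - e u * (e u * e v + e v * e u).
Proof. by move=> eD eB eM; rewrite !eB !eM !eD !eM. Qed.

Lemma mulr_linl (k : nzRingType) (A : lalgType k) (c : k) (u v w : A) :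
  (c *: u + v) * w = c *: (u * w) + v * w.
Proof. by rewrite mulrDl scalerAl. Qed.

Lemma mulr_linr (k : comNzRingType) (A : algType k) (c : k) (u v w : A) :
  u * (c *: v + w) = c *: (u * v) + u * w.
Proof. by rewrite mulrDr scalerAr. Qed.

(** The scalars act through a central morphism, which covers k-algebras as
well as matrix rings over a k-algebra. *)
Section UniversalProperty.
Variables (k : fieldType) (A : nzRingType) (iota : {rmorphism k -> A}) (a b : A).
Hypothesis iota_central : forall c u, iota c * u = u * iota c.

Definition wordEval (w : {fmonom bool}) : A :=
  \prod_(i <- (w : seq bool)) if i then b else a.

Fact wordEval_mmorphism : mmorphism wordEval.
Proof.
split=> [v w|]; last by rewrite /wordEval fm1 big_nil.
by rewrite /wordEval [mmul v w]fmmulE big_cat.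
Qed.
HB.instance Definition _ := isMultiplicative.Build _ _ wordEval wordEval_mmorphism.

Definition freeEval (f : freeAlg k) : A := mmap iota wordEval f.

Lemma freeEvalD : {morph freeEval : f g / f + g}.
Proof. exact: mmapD. Qed.

Lemma freeEvalB : {morph freeEval : f g / f - g}.
Proof. exact: mmapB. Qed.

Lemma freeEvalZ c f : freeEval (c *: f) = iota c * freeEval f.
Proof. exact: mmapZ. Qed.

Lemma freeEval1 : freeEval 1 = 1.
Proof. exact: mmap1. Qed.

Lemma freeEvalM : {morph freeEval : f g / f * g}.
Proof.
by have [] := @commr_mmap_is_multiplicative _ _ _ iota wordEval
  (fun f v w => iota_central _ _).
Qed.

Lemma freeEvalX : freeEval (freeX k) = a.
Proof. by rewrite [LHS]mmapU /= rmorph1 mul1r /wordEval fmuE big_seq1. Qed.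

Lemma freeEvalY : freeEval (freeY k) = b.
Proof. by rewrite [LHS]mmapU /= rmorph1 mul1r /wordEval fmuE big_seq1. Qed.

Hypothesis relXX : a ^+ 2 = 0.
Hypothesis relYZ :
  b * (a * b + b * a) - (a * b + b * a) * b - a * (a * b + b * a) = 0.

Lemma freeEval_ideal f : genIdeal (@sjpRel k) f -> freeEval f = 0.
Proof.
elim=> [g [] | | g h _ g0 _ h0 | g h _ h0 | g h _ h0].
- by rewrite expr2 freeEvalM freeEvalX -expr2.
- by rewrite (morph_relYZ _ _ freeEvalD freeEvalB freeEvalM) freeEvalX freeEvalY.
- exact: mmap0.
- by rewrite freeEvalD g0 h0 addr0.
- by rewrite freeEvalM h0 mulr0.
- by rewrite freeEvalM h0 mul0r.
Qed.

Lemma freeEval_repr f : freeEval (repr (sjp_pi f)) = freeEval f.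
Proof.
apply/eqP; rewrite -subr_eq0 -freeEvalB freeEval_ideal //.
by apply/sjp_piP; rewrite sjp_piK.
Qed.

Let sjpEval (u : sjp k) : A := freeEval (repr u).

Let sjpEval_zmod : zmod_morphism sjpEval.
Proof.
elim/sjp_ind=> f; elim/sjp_ind=> g.
by rewrite -[_ - _](raddfB (@sjp_pi k)) /sjpEval !freeEval_repr freeEvalB.
Qed.

Let sjpEval_monoid : monoid_morphism sjpEval.
Proof.
split; first by rewrite -(rmorph1 (@sjp_pi k)) /sjpEval freeEval_repr freeEval1.
elim/sjp_ind=> f; elim/sjp_ind=> g.
by rewrite -(rmorphM (@sjp_pi k)) /sjpEval !freeEval_repr freeEvalM.
Qed.

Lemma sjp_universal : exists phi : {rmorphism sjp k -> A},
  [/\ phi (sjpX k) = a, phi (sjpY k) = b &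
      forall c u, phi (c *: u) = iota c * phi u].
Proof.
pose additive_phi := GRing.isZmodMorphism.Build _ _ sjpEval sjpEval_zmod.
pose mult_phi := GRing.isMonoidMorphism.Build _ _ sjpEval sjpEval_monoid.
pose phi : {rmorphism sjp k -> A} := HB.pack sjpEval additive_phi mult_phi.
exists phi; split=> [||c]; rewrite /= /sjpEval.
- by rewrite freeEval_repr freeEvalX.
- by rewrite freeEval_repr freeEvalY.
by elim/sjp_ind=> f; rewrite -[c *: _]sjp_piZ !freeEval_repr freeEvalZ.
Qed.

End UniversalProperty.

Section Words.
Variable k : fieldType.
Notation B := (sjp k).
Notation x := (sjpX k).
Notation y := (sjpY k).

Definition sjpWord (l : seq bool) : B := \prod_(i <- l) if i then y else x.

Lemma sjp_pi_word l : sjp_pi (<< FMonom l >> : freeAlg k) = sjpWord l.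
Proof.
elim: l => [|i l IHl].
  by rewrite /sjpWord big_nil (_ : << _ >> = 1 :> freeAlg k) ?rmorph1 // -fmoneE.
rewrite /sjpWord big_cons -/(sjpWord l) -IHl.
have -> : << FMonom (i :: l) >> = << fmu i >> * << FMonom l >> :> freeAlg k.
  by rewrite [RHS]fgmulUU mulr1 /mmul /= fmmulE fmuE.
by rewrite rmorphM; congr (_ * _); case: i.
Qed.

Lemma sjp_pi_sum f :
  sjp_pi f = \sum_(w <- msupp (f : {malg k[{fmonom bool}]})) mcoeff w f *: sjpWord w.
Proof.
rewrite [f in LHS](monalgE (f : {malg k[{fmonom bool}]})).
rewrite (_ : \sum_(w <- _) _ = \sum_(w <- msupp f) (f@_w *: (<< w >> : freeAlg k))).
  rewrite linear_sum; apply: eq_bigr => -[l] _.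
  by rewrite linearZ /= sjp_pi_word.
apply: eq_bigr => w _; apply/malgP => u.
by rewrite mcoeffZ !mcoeffU mulr_natr.
Qed.

(** The shape of the induction hypotheses for subspaces of the algebra. *)
Definition lin_closed (P : B -> Prop) :=
  P 0 /\ forall c u v, P u -> P v -> P (c *: u + v).

Lemma sjp_homog_ind i (P : B -> Prop) : lin_closed P ->
  (forall l, odd (size l) = i -> P (sjpWord l)) ->
  forall u, @sjpHomog k i u -> P u.
Proof.
move=> [P0 PL] Pw u [f fi <-]; rewrite sjp_pi_sum big_seq.
elim/big_rec: _ => // w v w_f Pv; apply: PL => //.
by apply: Pw; rewrite -fdegE fi.
Qed.

Lemma sjp_word_ind (P : B -> Prop) : lin_closed P ->
  (forall l, P (sjpWord l)) -> forall u, P u.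
Proof.
move=> [P0 PL] Pw; elim/sjp_ind=> f; rewrite sjp_pi_sum.
by elim/big_rec: _ => // w v _ Pv; apply: PL.
Qed.

Lemma sjpHomog_word l : sjpHomog (odd (size l)) (sjpWord l).
Proof.
exists << FMonom l >>; last exact: sjp_pi_word.
move=> w /=; rewrite msuppU1 inE => /eqP ->; by rewrite fdegE.
Qed.

Lemma sjpHomog_lin i : lin_closed (@sjpHomog k i).
Proof.
split; first by exists 0; [move=> w /=; rewrite msupp0 inE | exact: raddf0].
move=> c u v [f fi <-] [g gi <-]; exists (c *: f + g); last by rewrite linearP.
move=> w /(fsubsetP (msuppD_le _ _)); rewrite in_fsetU => /orP[]; last exact: gi.
by move=> /(fsubsetP (msuppZ_le _ _)); apply: fi.
Qed.

Lemma sjpHomogM i j u v :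
  @sjpHomog k i u -> @sjpHomog k j v -> sjpHomog (i (+) j) (u * v : B).
Proof.
have [H0 HL] := @sjpHomog_lin (i (+) j) => ui vj; move: u ui v vj.
apply: sjp_homog_ind; first split=> [v _|c u u' Hu Hu' v vj].
- by rewrite mul0r.
- by rewrite mulr_linl; apply: HL; [apply: Hu | apply: Hu'].
move=> l li; apply: sjp_homog_ind; first split=> [|c v v' Hv Hv'].
- by rewrite mulr0.
- by rewrite mulr_linr; exact: HL Hv Hv'.
move=> l' lj; rewrite -[_ * _]big_cat -li -lj -oddD -size_cat.
exact: sjpHomog_word.
Qed.

Lemma sjpHomog1 : @sjpHomog k false (1 : B).
Proof. by have := sjpHomog_word [::]; rewrite /sjpWord big_nil. Qed.

Lemma sjpHomogX : @sjpHomog k true x.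
Proof. by have := sjpHomog_word [:: false]; rewrite /sjpWord big_seq1. Qed.

Lemma sjpHomogY : @sjpHomog k true y.
Proof. by have := sjpHomog_word [:: true]; rewrite /sjpWord big_seq1. Qed.

End Words.

(** * Normal forms and substitutions in an algebra with the defining relations *)

Lemma poly_unit_const (k : fieldType) (a b : {poly k}) :
  a * b = 1 -> exists2 mu, mu != 0 & a = mu%:P.
Proof.
move=> ab1; have /andP[/size_poly1P[mu nz_mu ->] _]: a \in GRing.unit.
  by apply/unitrP; exists b; rewrite mulrC ab1.
by exists mu.
Qed.

Lemma polyMXaddC_inj (R : nzRingType) (p q : {poly R}) a b :
  p * 'X + a%:P = q * 'X + b%:P -> p = q /\ a = b.
Proof.
move=> /polyP e; split.
  by apply/polyP => i; have := e i.+1; rewrite !coefD !coefMX !coefC !addr0.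
by have := e 0%N; rewrite !coefD !coefMX !coefC !add0r.
Qed.

Lemma horner_algMXaddC (k : fieldType) (A : algType k) (z : A) c a :
  horner_alg z (c * 'X + a%:P) = horner_alg z c * z + a%:A.
Proof. by rewrite rmorphD rmorphM /= horner_algX horner_algC. Qed.

Section NormalForm.
Variables (k : fieldType) (A : algType k) (x y z : A).
Hypothesis zE : z = x * y + y * x.
Hypothesis relXX : x ^+ 2 = 0.
Hypothesis relYZ : y * z - z * y - x * z = 0.

Notation zpol := (horner_alg z).

Let xx : x * x = 0. Proof. exact: relXX. Qed.

Let yz : y * z = z * y + x * z.
Proof. by apply/eqP; rewrite -subr_eq0 opprD addrA relYZ. Qed.

Let xz : x * z = z * x.
Proof. by rewrite zE mulrDl mulrDr -!mulrA xx mulr0 addr0 !mulrA xx mul0r add0r. Qed.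

Let yx : y * x = z - x * y.
Proof. by rewrite zE addrC addKr. Qed.

Lemma zpol_comm c u : u * z = z * u -> u * zpol c = zpol c * u.
Proof.
move=> uz; elim/poly_ind: c => [|c a IH]; first by rewrite rmorph0 mulr0 mul0r.
rewrite horner_algMXaddC mulrDr mulrDl mulrA IH.
by rewrite -!mulrA uz mulr_algl mulr_algr.
Qed.

Lemma x_zpol c : x * zpol c = zpol c * x.
Proof. exact: zpol_comm. Qed.

(** Commuting y past z produces x z, and x commutes with z: the error term
is always x times a polynomial in z. *)
Lemma y_zpol c : exists e, y * zpol c = zpol c * y + x * zpol e.
Proof.
elim/poly_ind: c => [|c a [e IH]].
  by exists 0; rewrite rmorph0 !mulr0 mul0r addr0.
exists (c * 'X + e * 'X).
rewrite !rmorphD !rmorphM /= horner_algX horner_algC mulrDr mulrA IH !mulrDl.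
rewrite -(mulrA _ y z) yz !mulrDr mulr_algl mulr_algr !mulrA !x_zpol.
by rewrite -!addrA; congr (_ + _); rewrite addrA [RHS]addrC.
Qed.

(** The outer variable stands for y ^+ 2 and the inner one for z: these are
the ordered monomials of the Jordan plane sitting in the even part. *)
Definition sjpPsi (f : {poly {poly k}}) : A := (map_poly zpol f).[y ^+ 2].
Notation psi := sjpPsi.

Lemma sjpPsiD : {morph psi : f g / f + g}.
Proof. by move=> f g; rewrite /psi rmorphD hornerD. Qed.

Lemma sjpPsiN : {morph psi : f / - f}.
Proof. by move=> f; rewrite /psi rmorphN hornerN. Qed.

Lemma sjpPsiC c : psi c%:P = zpol c.
Proof. by rewrite /psi map_polyC hornerC. Qed.

Lemma sjpPsi0 : psi 0 = 0.
Proof. by rewrite /psi rmorph0 horner0. Qed.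

Lemma sjpPsiMX f : psi (f * 'X) = psi f * y ^+ 2.
Proof. by rewrite /psi rmorphM /= map_polyX hornerMX. Qed.

Lemma sjpPsiMXaddC f c : psi (f * 'X + c%:P) = psi f * y ^+ 2 + zpol c.
Proof. by rewrite sjpPsiD sjpPsiC sjpPsiMX. Qed.

Lemma sjpPsiZ c f : psi (c *: f) = zpol c * psi f.
Proof. by rewrite /psi map_polyZ hornerZ. Qed.

Lemma y_psi f : exists g, y * psi f = psi f * y + x * psi g.
Proof.
elim/poly_ind: f => [|f c [g IH]].
  by exists 0; rewrite sjpPsi0 !mulr0 mul0r addr0.
have [e ye] := y_zpol c; exists (g * 'X + e%:P).
rewrite !sjpPsiMXaddC mulrDr mulrA IH ye !mulrDl mulrDr expr2 !mulrA.
by rewrite addrACA.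
Qed.

Lemma z_psi f : z * psi f = psi ('X *: f).
Proof. by rewrite sjpPsiZ /= horner_algX. Qed.

Lemma xx_psi f : x * (x * psi f) = 0.
Proof. by rewrite mulrA xx mul0r. Qed.

Lemma yx_psi f :
  y * (x * psi f) = psi ('X *: f) - x * psi f * y - x * (y * psi f - psi f * y).
Proof.
rewrite mulrA yx mulrBl z_psi mulrBr !mulrA opprB -!addrA; congr (_ + _).
by rewrite addKr.
Qed.

(** The monomials x^a z^b y^c with a <= 1, grouped by the value of a and the
parity of c. *)
Definition normal_form p r q s : A := psi p + psi r * y + x * psi q + x * psi s * y.

Lemma normal_form_odd r q : normal_form 0 r q 0 = psi r * y + x * psi q.
Proof. by rewrite /normal_form sjpPsi0 mulr0 mul0r add0r addr0. Qed.

Lemma normal_form_even p s : normal_form p 0 0 s = psi p + x * (psi s * y).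
Proof. by rewrite /normal_form sjpPsi0 mulr0 mul0r !addr0 mulrA. Qed.

Definition has_normal_form u := exists p r q s, u = normal_form p r q s.

Lemma normal_form_lin c u v :
  has_normal_form u -> has_normal_form v -> has_normal_form (c *: u + v).
Proof.
have cpsi f : psi (c%:P *: f) = c *: psi f.
  by rewrite sjpPsiZ /= horner_algC mulr_algl.
move=> [p [r [q [s ->]]]] [p' [r' [q' [s' ->]]]].
exists (c%:P *: p + p'), (c%:P *: r + r'), (c%:P *: q + q'), (c%:P *: s + s').
rewrite /normal_form !sjpPsiD !cpsi !(mulrDl, mulrDr) !scalerDr -!(scalerAl, scalerAr).
by rewrite addrACA; congr (_ + _); rewrite addrACA; congr (_ + _); rewrite addrACA.
Qed.

Lemma normal_form0 : has_normal_form 0.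
Proof.
by exists 0, 0, 0, 0; rewrite /normal_form !sjpPsi0 !mulr0 !mul0r !addr0.
Qed.

Lemma normal_form1 : has_normal_form 1.
Proof.
exists 1%:P, 0, 0, 0; rewrite /normal_form sjpPsiC rmorph1.
by rewrite !sjpPsi0 !mulr0 !mul0r !addr0.
Qed.

Lemma normal_form_mulx u : has_normal_form u -> has_normal_form (x * u).
Proof.
move=> [p [r [q [s ->]]]]; exists 0, 0, p, r.
by rewrite /normal_form sjpPsi0 mul0r addr0 add0r !mulrDr !mulrA xx !mul0r !addr0.
Qed.

(** Stability under left multiplication by the generators is the spanning
half of the basis theorem; independence is obtained from a representation. *)
Lemma normal_form_muly u : has_normal_form u -> has_normal_form (y * u).
Proof.
move=> [p [r [q [s ->]]]].
have [p' yp] := y_psi p; have [r' yr] := y_psi r.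
have [q' yq] := y_psi q; have [s' ys] := y_psi s.
have y_x_psi f g : y * psi f = psi f * y + x * psi g ->
  y * (x * psi f) = psi ('X *: f) - x * psi f * y.
  by move=> yf; rewrite yx_psi yf (addrC (psi f * y)) addrK xx_psi subr0.
exists ('X *: q + r * 'X), (p + 'X *: s), (p' - s * 'X), (r' - q).
rewrite /normal_form !mulrDr !(mulrA y _ y) (y_x_psi _ _ yq) (y_x_psi _ _ ys) yp yr.
rewrite !(sjpPsiD, sjpPsiN, sjpPsiMX) !(mulrDl, mulrDr, mulrN, mulNr) expr2 !mulrA.
by rewrite [LHS](AC (2*2*2*2) (5*3*(1*7)*(2*8)*(4*6))).
Qed.

Lemma y_zpol_x c : y * (zpol c * x) = zpol c * (y * x).
Proof.
have [e ye] := y_zpol c.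
by rewrite mulrA ye mulrDl -!mulrA -x_zpol (mulrA x x) xx mul0r addr0.
Qed.

(** The pair (x', y') satisfies the defining relations again, with
mu ^+ 2 *: z in the place of z. *)
Section Twist.
Variables (mu : k) (s : {poly k}).
Let x' := mu *: x.
Let y' := mu *: y + zpol s * x.

Lemma twist_xx : x' ^+ 2 = 0.
Proof. by rewrite /x' exprZn relXX scaler0. Qed.

Lemma twist_xy : x' * y' = mu ^+ 2 *: (x * y).
Proof.
rewrite mulrDr -!(scalerAl, scalerAr) scalerA -expr2 mulrA x_zpol.
by rewrite -mulrA xx mulr0 scaler0 addr0.
Qed.

Lemma twist_z : x' * y' + y' * x' = mu ^+ 2 *: z.
Proof.
rewrite twist_xy mulrDl -!(scalerAl, scalerAr) -mulrA xx mulr0 scaler0 addr0.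
by rewrite scalerA -expr2 zE scalerDr.
Qed.

Lemma twist_yz : y' * (mu ^+ 2 *: z) - mu ^+ 2 *: z * y' - x' * (mu ^+ 2 *: z) = 0.
Proof.
rewrite -(scalerAr _ y') -(scalerAl _ z) -(scalerAr _ x') -!scalerBr /x' /y'.
have Sxz : zpol s * x * z = z * (zpol s * x).
  by rewrite -mulrA xz !mulrA zpol_comm.
rewrite mulrDl mulrDr Sxz -!(scalerAl, scalerAr) opprD addrACA subrr addr0.
by rewrite -!scalerBr relYZ !scaler0.
Qed.

Lemma twist_yy : y' ^+ 2 = mu ^+ 2 *: y ^+ 2 + mu *: (z * zpol s).
Proof.
rewrite /y' expr2 mulrDl !mulrDr -!(scalerAl, scalerAr) scalerA -expr2 -addrA.
congr (_ + _); rewrite -!mulrA (mulrA x) x_zpol -(mulrA _ x x) xx !mulr0 addr0.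
by rewrite y_zpol_x -scalerDr -mulrDr addrC -zE zpol_comm.
Qed.

End Twist.

End NormalForm.

(** * Two by two matrices over the Jordan plane *)

Section SkewConst.
Variables (R : comNzRingType) (d : derivation R).

Definition skewC (c : R) : skewPoly d := c%:P.

Fact skewC_zmod : zmod_morphism skewC.
Proof. exact: polyCB. Qed.

Fact skewC_monoid : monoid_morphism skewC.
Proof.
split=> // b c.
by rewrite [RHS]skew_mulCl /skewC polyCM mul_polyC.
Qed.

HB.instance Definition _ := GRing.isZmodMorphism.Build R (skewPoly d) skewC skewC_zmod.
HB.instance Definition _ := GRing.isMonoidMorphism.Build R (skewPoly d) skewC skewC_monoid.

Lemma skewC_central c (f : skewPoly d) : d c = 0 -> skewC c * f = f * skewC c.
Proof.
move=> dc0; rewrite [LHS]skew_mulCl -[f in LHS](@skew_mulr1 _ d).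
rewrite [RHS]/(skew_mul d f _) /skew_mul scaler_sumr; apply: eq_bigr => i _.
have -> : iter i (skewT d) c%:P = c *: 'X^i.
  elim: (i : nat) => [|j IH]; first by rewrite -mul_polyC mulr1.
  by rewrite iterS IH skewTZ dc0 scale0r addr0 -(iter_skewT1 d) -iterS iter_skewT1.
by rewrite iter_skewT1 !scalerA mulrC.
Qed.

End SkewConst.

Section Mx2.
Variable J : nzRingType.
Implicit Types (p q r s : J).

Definition mx2 p q r s : 'M[J]_2 :=
  \matrix_(i, j) if i == 0 then (if j == 0 then p else q)
                 else (if j == 0 then r else s).

Lemma mx2M p q r s p' q' r' s' :
  mx2 p q r s * mx2 p' q' r' s' =
  mx2 (p * p' + q * r') (p * q' + q * s') (r * p' + s * r') (r * q' + s * s').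
Proof.
apply/matrixP => i j; rewrite !mxE !big_ord_recl big_ord0 addr0 !mxE /=.
by case: i => [[|[|i]] ?] //; case: j => [[|[|j]] ?].
Qed.

Lemma mx2D p q r s p' q' r' s' :
  mx2 p q r s + mx2 p' q' r' s' = mx2 (p + p') (q + q') (r + r') (s + s').
Proof. by apply/matrixP => i j; rewrite !mxE; do 2![case: ifP]. Qed.

Lemma mx2N p q r s : - mx2 p q r s = mx2 (- p) (- q) (- r) (- s).
Proof. by apply/matrixP => i j; rewrite !mxE; do 2![case: ifP]. Qed.

Lemma mx2_0 : mx2 0 0 0 0 = 0.
Proof. by apply/matrixP => i j; rewrite !mxE; do 2![case: ifP]. Qed.

Lemma mx2_scalar p : mx2 p 0 0 p = p%:M.
Proof.
apply/matrixP => i j; rewrite !mxE.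
by case: i => [[|[|i]] ?] //; case: j => [[|[|j]] ?].
Qed.

Lemma mx2_inj p q r s p' q' r' s' : mx2 p q r s = mx2 p' q' r' s' ->
  [/\ p = p', q = q', r = r' & s = s'].
Proof.
move=> /matrixP e.
by move: (e 0 0) (e 0 1) (e 1 0) (e 1 1); rewrite !mxE /=.
Qed.

Lemma mx2_eta (M : 'M[J]_2) : M = mx2 (M 0 0) (M 0 1) (M 1 0) (M 1 1).
Proof.
apply/matrixP => i j; rewrite !mxE.
by case: i => [[|[|i]] ?] //; case: j => [[|[|j]] ?] //=; congr (M _ _); apply: val_inj.
Qed.

End Mx2.

(** As soon as t * w = w * t + w * w, the matrices modelX and modelY satisfy
the relations of the super Jordan plane, z becomes the scalar matrix w, and
y ^+ 2 the scalar matrix t.  Diagonal matrices are the even elements and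
antidiagonal ones the odd elements. *)
Section MatrixModel.
Variables (J : nzRingType) (w t : J).
Implicit Types (a b c p q r s : J) (M N : 'M[J]_2).
Let simp := (mul0r, mulr0, addr0, add0r, mulr1, mul1r, oppr0).

Lemma mx2_scalar_central c M :
  (forall a, c * a = a * c) -> mx2 c 0 0 c * M = M * mx2 c 0 0 c.
Proof. by move=> cC; rewrite [M]mx2_eta !mx2M !simp !cC. Qed.

Definition modelX : 'M[J]_2 := mx2 0 w 0 0.
Definition modelY : 'M[J]_2 := mx2 0 t 1 0.

Lemma modelZ : modelX * modelY + modelY * modelX = mx2 w 0 0 w.
Proof. by rewrite !mx2M mx2D !simp. Qed.

Lemma modelYY : modelY ^+ 2 = mx2 t 0 0 t.
Proof. by rewrite expr2 mx2M !simp. Qed.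

Lemma model_xx : modelX ^+ 2 = 0.
Proof. by rewrite expr2 mx2M !simp mx2_0. Qed.

Lemma model_yz (Z := modelX * modelY + modelY * modelX) :
  t * w = w * t + w * w -> modelY * Z - Z * modelY - modelX * Z = 0.
Proof.
move=> tw; rewrite /Z modelZ !mx2M !simp !mx2N !mx2D tw !simp.
by rewrite addrAC addrK !subrr mx2_0.
Qed.

Lemma model_normal_form p r q s :
  mx2 p 0 0 p + mx2 r 0 0 r * modelY + modelX * mx2 q 0 0 q
    + modelX * mx2 s 0 0 s * modelY =
  mx2 (p + w * s) (r * t + w * q) r p.
Proof. by rewrite !mx2M !mx2D !simp. Qed.

Lemma mx2_scalar_diag c p s : mx2 c 0 0 c * mx2 p 0 0 s = mx2 (c * p) 0 0 (c * s).
Proof. by rewrite mx2M !simp. Qed.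

Lemma model_mx2C a b c : mx2 a 0 0 a * mx2 b 0 0 b + mx2 c 0 0 c =
  mx2 (a * b + c) 0 0 (a * b + c).
Proof. by rewrite mx2M mx2D !simp. Qed.

Lemma model_yxy : modelY * modelX * modelY = mx2 0 0 w 0.
Proof. by rewrite !mx2M !simp. Qed.

Lemma model_yxy_scalar a b : mx2 0 0 a 0 * mx2 b 0 0 b = mx2 0 0 (a * b) 0.
Proof. by rewrite mx2M !simp. Qed.

Lemma modelX_scalar b : modelX * mx2 b 0 0 b = mx2 0 (w * b) 0 0.
Proof. by rewrite mx2M !simp. Qed.

Lemma modelX_mul M :
  [/\ (modelX * M) 0 1 = w * M 1 1, (modelX * M) 1 0 = 0 & (modelX * M) 1 1 = 0].
Proof. by rewrite [M]mx2_eta mx2M !simp !mxE. Qed.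

(** Only the lower left corner of the middle factor is nonzero, so the entry
is a single product; for y * x * y this confines divisors of x. *)
Lemma mul_mx2_01 c M N : (M * mx2 0 0 c 0 * N) 0 1 = M 0 1 * c * N 0 1.
Proof. by rewrite [M]mx2_eta [N]mx2_eta !mx2M !simp !mxE. Qed.

Lemma antidiag_modelX_antidiag b c M :
  (mx2 0 b c 0 * modelX * mx2 0 b c 0 * M) 1 0 = c * w * c * M 0 0.
Proof. by rewrite [M]mx2_eta !mx2M !simp !mxE. Qed.

Lemma antidiag_Z b c (Y := mx2 0 b c 0) :
  modelX * Y + Y * modelX = mx2 (w * c) 0 0 (c * w).
Proof. by rewrite !mx2M mx2D !simp. Qed.

Lemma antidiag_sqr b c : mx2 0 b c 0 * mx2 0 b c 0 = mx2 (b * c) 0 0 (c * b).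
Proof. by rewrite !mx2M !simp. Qed.

Lemma mul_diag_11 M a b : (M * mx2 a 0 0 b) 1 1 = M 1 1 * b.
Proof. by rewrite [M]mx2_eta !mx2M !simp !mxE. Qed.

(** The upper right entry of the defining relation, evaluated at an
antidiagonal image of y and an upper triangular image of x. *)
Lemma antidiag_relYZ a b c (X := mx2 0 a 0 0) (Y := mx2 0 b c 0) :
  Y * (X * Y + Y * X) - (X * Y + Y * X) * Y - X * (X * Y + Y * X) = 0 ->
  b * (c * a) - a * c * b - a * (c * a) = 0.
Proof.
rewrite !mx2M !simp !mx2D !simp !mx2M !simp !mx2N !mx2D -mx2_0.
by case/mx2_inj.
Qed.

Definition mx2_parity (i : bool) M :=
  if i then M 0 0 = 0 /\ M 1 1 = 0 else M 0 1 = 0 /\ M 1 0 = 0.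

Lemma mx2_parity_modelX i M : mx2_parity i M -> mx2_parity (~~ i) (modelX * M).
Proof.
by rewrite [M]mx2_eta /mx2_parity mx2M; case: i; rewrite !mxE /= => -[-> ->];
   rewrite !simp.
Qed.

Lemma mx2_parity_modelY i M : mx2_parity i M -> mx2_parity (~~ i) (modelY * M).
Proof.
by rewrite [M]mx2_eta /mx2_parity mx2M; case: i; rewrite !mxE /= => -[-> ->];
   rewrite !simp.
Qed.

Lemma mx2_parity_lin i c M N :
  mx2_parity i M -> mx2_parity i N -> mx2_parity i (mx2 c 0 0 c * M + N).
Proof.
rewrite [M]mx2_eta [N]mx2_eta /mx2_parity mx2M mx2D.
by case: i; rewrite !mxE /= => -[-> ->] [-> ->]; rewrite !simp.
Qed.

Lemma mx2_parity0 i : mx2_parity i 0.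
Proof. by case: i; rewrite /mx2_parity !mxE. Qed.

Lemma mx2_parity1 : mx2_parity false 1.
Proof. by rewrite /mx2_parity !mxE. Qed.

End MatrixModel.

Section Model.
Variable k : fieldType.

(** The derivation w^2 d/dw, whose skew polynomial ring is the Jordan plane
t w - w t = w^2. *)
Definition wder_fun (f : {poly k}) : {poly k} := 'X^2 * f^`().

Fact wder_funD f g : wder_fun (f + g) = wder_fun f + wder_fun g.
Proof. by rewrite /wder_fun derivD mulrDr. Qed.

Fact wder_funM f g : wder_fun (f * g) = f * wder_fun g + wder_fun f * g.
Proof. by rewrite /wder_fun derivM mulrDr addrC mulrCA [X in _ + X]mulrA. Qed.

Definition wder : derivation {poly k} := Derivation wder_funD wder_funM.

Lemma wderX : wder 'X = 'X^2.
Proof. by rewrite /= /wder_fun derivX mulr1. Qed.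

Lemma wderC c : wder c%:P = 0.
Proof. by rewrite /= /wder_fun derivC mulr0. Qed.

Notation J := (skewPoly wder).
Definition jordanW : J := 'X%:P.
Definition jordanT : J := 'X.
Notation w := jordanW.
Notation t := jordanT.

Lemma jordan_tw : t * w = w * t + w * w.
Proof.
rewrite [LHS]skew_mulXl skewTC wderX [w * t]skew_mulCl [w * w]skew_mulCl.
by congr (_ + _); rewrite /w -mul_polyC -polyCM -expr2.
Qed.

Definition modelC := [the {rmorphism k -> 'M[J]_2} of scalar_mx \o (skewC wder \o polyC)].

Lemma modelCE c : modelC c = mx2 (c%:P%:P : J) 0 0 c%:P%:P.
Proof. by rewrite mx2_scalar. Qed.

Lemma modelC_central c M : modelC c * M = M * modelC c.
Proof.
rewrite modelCE; apply: mx2_scalar_central => a.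
exact: skewC_central (wderC c).
Qed.

End Model.

(** * Parity-preserving automorphisms in the matrix model *)

(** Here A is an algebra with the relations of the super Jordan plane,
spanned by the normal forms, and rho is the matrix representation over the
Jordan plane J.  The ring J is given through its coordinate map j, which
keeps products of polynomials apart from products in J. *)
Section Representation.
Variables (k : fieldType) (A : algType k) (x y z : A).
Hypotheses (zE : z = x * y + y * x) (relXX : x ^+ 2 = 0)
  (relYZ : y * z - z * y - x * z = 0).
Hypothesis spanned : forall u, has_normal_form x y z u.

Variables (J : nzRingType) (j : {poly {poly k}} -> J).
Hypotheses (jD : {morph j : f g / f + g})
  (jM : forall f g, j f * j g = j (skew_mul (wder k) f g))
  (j_inj : injective j) (j_surj : forall a, exists f, a = j f).
Notation w := (j 'X%:P).
Notation t := (j 'X).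

Variable rho : {rmorphism A -> 'M[J]_2}.
Hypotheses (rhoX : rho x = modelX w) (rhoY : rho y = modelY t).
Hypothesis rhoZ : forall c u, rho (c *: u) = mx2 (j c%:P%:P) 0 0 (j c%:P%:P) * rho u.

Notation zpol := (horner_alg z).
Notation psi := (sjpPsi y z).
Notation nf := (normal_form x y z).

Let rhoD u v : rho (u + v) = rho u + rho v. Proof. exact: rmorphD. Qed.
Let rhoM u v : rho (u * v) = rho u * rho v. Proof. exact: rmorphM. Qed.

Let j0 : j 0 = 0.
Proof. by apply: (addrI (j 0)); rewrite -jD !addr0. Qed.

Let jCM c f : j c%:P * j f = j (c *: f).
Proof. by rewrite jM skew_mulCl. Qed.

Let jMt f : j f * t = j (f * 'X).
Proof. by rewrite jM skew_mulXr. Qed.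

Lemma rho_z : rho z = mx2 w 0 0 w.
Proof. by rewrite zE rhoD !rhoM rhoX rhoY modelZ. Qed.

Lemma rho_zpol c : rho (zpol c) = mx2 (j c%:P) 0 0 (j c%:P).
Proof.
elim/poly_ind: c => [|c a IH]; first by rewrite !raddf0 j0 mx2_0.
rewrite horner_algMXaddC rhoD rhoM IH rho_z rhoZ rmorph1 mulr1 model_mx2C jCM -jD.
by rewrite -mul_polyC -polyCM -polyCD.
Qed.

Lemma rho_psi f : rho (psi f) = mx2 (j f) 0 0 (j f).
Proof.
elim/poly_ind: f => [|f c IH]; first by rewrite sjpPsi0 raddf0 j0 mx2_0.
rewrite sjpPsiMXaddC rhoD rhoM (rmorphXn rho) rho_zpol IH rhoY.
by rewrite modelYY model_mx2C jMt jD.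
Qed.

Lemma rho_nf p r q s :
  rho (nf p r q s) = mx2 (j (p + 'X *: s)) (j (r * 'X + 'X *: q)) (j r) (j p).
Proof.
by rewrite !rhoD !rhoM !rho_psi rhoX rhoY model_normal_form jMt !jCM !jD.
Qed.

Let scaleX_inj : injective ( *:%R ('X : {poly k}) : {poly {poly k}} -> _).
Proof.
move=> f g /eqP; rewrite -subr_eq0 -scalerBr -mul_polyC mulf_eq0.
by rewrite polyC_eq0 polyX_eq0 subr_eq0 => /eqP.
Qed.

Let scaleX_eq0 (f : {poly {poly k}}) : 'X *: f = 0 -> f = 0.
Proof. by move=> f0; apply: scaleX_inj; rewrite f0 scaler0. Qed.

(** The four coefficients of a normal form can be read off its matrix,
because multiplication by w is injective. *)
Lemma rho_inj : injective rho.
Proof.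
move=> u v; have [p [r [q [s ->]]]] := spanned u.
have [p' [r' [q' [s' ->]]]] := spanned v.
rewrite !rho_nf => /mx2_inj[/j_inj e11 /j_inj e12 /j_inj er /j_inj ep].
rewrite er ep in e11 e12 *.
by rewrite (scaleX_inj (addrI _ e11)) (scaleX_inj (addrI _ e12)).
Qed.

Definition parity (i : bool) (u : A) := mx2_parity i (rho u).

Lemma odd_normal_form u : parity true u -> exists r q, u = nf 0 r q 0.
Proof.
have [p [r [q [s ->]]]] := spanned u.
rewrite /parity rho_nf /mx2_parity !mxE /= -j0 => -[/j_inj ps0 /j_inj p0].
by exists r, q; rewrite p0 add0r in ps0 *; rewrite (scaleX_eq0 ps0).
Qed.

Lemma even_normal_form u : parity false u -> exists p s, u = nf p 0 0 s.
Proof.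
have [p [r [q [s ->]]]] := spanned u.
rewrite /parity rho_nf /mx2_parity !mxE /= -j0 => -[/j_inj rq0 /j_inj r0].
by exists p, s; rewrite r0 mul0r add0r in rq0 *; rewrite (scaleX_eq0 rq0).
Qed.

Lemma rho_x_psi q : rho (x * psi q) = mx2 0 (j ('X *: q)) 0 0.
Proof. by rewrite rhoM rhoX rho_psi modelX_scalar jCM. Qed.

Lemma rho_yxy : rho (y * x * y) = mx2 0 0 w 0.
Proof. by rewrite !rhoM rhoY rhoX model_yxy. Qed.

Lemma rho_yxy_psi v : rho (y * x * y * psi v) = mx2 0 0 (j ('X *: v)) 0.
Proof. by rewrite rhoM rho_yxy rho_psi model_yxy_scalar jCM. Qed.

(** In an antidiagonal matrix of square zero one of the two corners vanishes,
as J is a domain.  If the lower one does, the element is x psi(q); if the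
upper one does, r t + w q = 0 forces r to be a multiple of w, and
y * x * y is the matrix with lower corner w. *)
Lemma odd_square_zero u : parity true u -> u ^+ 2 = 0 ->
  (exists q, u = x * psi q) \/ (exists v, u = y * x * y * psi v).
Proof.
move=> /odd_normal_form[r [q ->]] /(congr1 rho).
rewrite (rmorphXn rho) raddf0 rho_nf scaler0 addr0 j0 expr2 antidiag_sqr -mx2_0.
case/mx2_inj; rewrite jM -j0 => /j_inj/skew_mul_eq0/orP[]/eqP b0 _ _ _; last first.
  left; exists q; rewrite /normal_form b0 !sjpPsi0.
  by rewrite mulr0 !mul0r !add0r addr0.
right; elim/poly_ind: q b0 => [|q c _].
  rewrite scaler0 addr0 => /eqP; rewrite mulf_eq0 polyX_eq0 orbF => /eqP ->.
  by exists 0; rewrite /normal_form !sjpPsi0 !(mulr0, mul0r, addr0).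
rewrite scalerDr scalerAl addrA -mulrDl -[_ *: c%:P]mul_polyC -polyCM.
rewrite -[RHS](_ : 0 * 'X + 0%:P = 0); last by rewrite mul0r addr0.
move=> /polyMXaddC_inj[/eqP rq /eqP].
rewrite mulf_eq0 polyX_eq0 => /eqP->; rewrite addr0.
(* Now r = - w q, so that the coefficient of y * x * y is - q. *)
exists (- q); apply: rho_inj; move: rq; rewrite addr_eq0 => /eqP ->.
rewrite rho_nf rho_yxy_psi scaler0 addr0 scalerN j0; congr mx2.
by rewrite mulNr scalerAl addNr j0.
Qed.

Lemma j_const f g c : c != 0 -> j f * j g = j c%:P ->
  exists a b, [/\ f = a%:P, g = b%:P & a * b = c].
Proof. by move=> nz_c; rewrite jM => /j_inj/(skew_mul_const nz_c). Qed.

(** The corner of u * (y * x * y) * v is U w V, with U and V the upper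
corners of u and v.  If it were w, then U would be a unit of k by degrees;
but U = r t + w q has no constant term. *)
Lemma x_neq_mul_yxy u v : x = u * (y * x * y) * v -> False.
Proof.
move=> /(congr1 (fun b => rho b 0 1)); rewrite rhoX !(rhoM _ v) (rhoM u) rho_yxy.
rewrite mul_mx2_01 mxE /=.
have [p [r [q [s ->]]]] := spanned u; rewrite rho_nf mxE /=.
have [f ->] := j_surj (rho v 0 1).
have nzX := negbT (polyX_eq0 k).
rewrite jM => /esym/(j_const nzX)[a [b [rqX _ abX]]].
have nz_a : a != 0 by apply: contraNneq nzX => a0; rewrite -abX a0 mul0r.
have [c [d [rq /polyC_inj dX cda]]] := skew_mul_const nz_a rqX.
(* The constant term in t of r t + w q is a multiple of w. *)
have cE : c = 'X * q`_0.
  by move/(congr1 (fun g : {poly {poly k}} => g`_0)): rq;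
     rewrite coefD coefMX coefZ coefC add0r.
have /poly_unit_const[mu _ /(congr1 (fun p : {poly k} => size p))] : 'X * (q`_0 * b) = 1.
  apply: (mulIf nzX); rewrite mul1r -[RHS]abX -cda -dX cE.
  by rewrite -!mulrA; congr (_ * (_ * _)); rewrite mulrC.
by rewrite size_polyX size_polyC; case: eqP.
Qed.

Lemma parity_x : parity true x.
Proof. by rewrite /parity rhoX /mx2_parity !mxE. Qed.

Lemma parity_yxy : parity true (y * x * y).
Proof. by rewrite /parity rho_yxy /mx2_parity !mxE. Qed.

Lemma yxy_sqr : (y * x * y) ^+ 2 = 0.
Proof.
apply: rho_inj; rewrite (rmorphXn rho) raddf0 rho_yxy expr2 antidiag_sqr.
by rewrite mul0r mulr0 mx2_0.
Qed.

Section Automorphism.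
Variables sigma tau : {rmorphism A -> A}.
Hypotheses (tauK : forall u, sigma (tau u) = u)
  (sigma_par : forall i u, parity i u -> parity i (sigma u))
  (tau_par : forall i u, parity i u -> parity i (tau u)).

Let sigmaM u v : sigma (u * v) = sigma u * sigma v. Proof. exact: rmorphM. Qed.
Let sigmaD u v : sigma (u + v) = sigma u + sigma v. Proof. exact: rmorphD. Qed.

(** The image of x is odd of square zero.  If it were a multiple of
y * x * y, then x, the image of tau x, would be one too, whichever of the
two shapes tau x has. *)
Lemma image_x_multiple : exists q, sigma x = x * psi q.
Proof.
have sq0 (f : {rmorphism A -> A}) : f x ^+ 2 = 0 by rewrite -rmorphXn relXX raddf0.
have [//|[v sx]] := odd_square_zero (sigma_par parity_x) (sq0 sigma).
have [[q tx]|[q tx]] := odd_square_zero (tau_par parity_x) (sq0 tau); exfalso.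
  apply: (@x_neq_mul_yxy 1 (psi v * sigma (psi q))).
  by rewrite -{1}(tauK x) tx sigmaM sx mul1r !mulrA.
apply: (@x_neq_mul_yxy (sigma y) (psi v * sigma y * sigma (psi q))).
by rewrite -{1}(tauK x) tx !sigmaM sx !mulrA.
Qed.

Variables (qx qx' : {poly {poly k}}).
Hypotheses (sigma_xE : sigma x = x * psi qx) (tau_xE : tau x = x * psi qx').

(** Reading x = sigma (tau x) in the upper right corner gives
w = w qx f for some f, hence qx is a unit. *)
Lemma image_x_scalar : exists2 mu, mu != 0 & sigma x = mu *: x.
Proof.
have : rho (sigma (tau x)) 0 1 = rho x 0 1 by rewrite tauK.
rewrite tau_xE sigmaM sigma_xE rhoM rho_x_psi rhoX.
have [-> _ _] := modelX_mul (j ('X *: qx)) (rho (sigma (psi qx'))).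
have [f ->] := j_surj (rho (sigma (psi qx')) 1 1).
have nzX := negbT (polyX_eq0 k).
rewrite mxE /= => /(j_const nzX)[a [b [Xq _ abX]]].
have coef_q i : 'X * qx`_i = (a%:P)`_i by rewrite -Xq coefZ.
have qxE : qx = (qx`_0)%:P.
  apply: scaleX_inj; apply/polyP => i; rewrite !coefZ coef_q !coefC.
  by case: i => [|i]; rewrite ?mulr0 //= coef_q coefC.
have [mu nz_mu qx0] : exists2 mu, mu != 0 & qx`_0 = mu%:P.
  apply: (@poly_unit_const _ _ b); apply: (mulfI nzX).
  by rewrite mulrA coef_q coefC abX mulr1.
exists mu => //; rewrite qxE qx0 sjpPsiC horner_algC.
by rewrite -scalerAr mulr1.
Qed.

Variable mu : k.
Hypotheses (sigmaZ : forall c u, sigma (c *: u) = c *: sigma u)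
  (nz_mu : mu != 0) (sigma_x_mu : sigma x = mu *: x).

(** The preimage of y * x * y has the shape (y * x * y) * psi v, the other
shape being killed by x on the left.  Its image has lower corner
mu c w c f, where c is the lower corner of sigma y, and equating it with w
makes c a unit. *)
Lemma image_y_corner_scalar : exists nu q,
  nu != 0 /\ sigma y = nf 0 nu%:P%:P q 0.
Proof.
have [r [q sy]] : exists r q, sigma y = nf 0 r q 0.
  apply/odd_normal_form/sigma_par.
  by rewrite /parity rhoY /mx2_parity !mxE.
have rho_sy : rho (sigma y) = mx2 0 (j (r * 'X + 'X *: q)) (j r) 0.
  by rewrite sy rho_nf scaler0 addr0 j0.
have tyxy0 : tau (y * x * y) ^+ 2 = 0 by rewrite -rmorphXn yxy_sqr raddf0.
have : rho (sigma (tau (y * x * y))) 1 0 = rho (y * x * y) 1 0 by rewrite tauK.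
have nzX := negbT (polyX_eq0 k).
have [[v ->]|[v ->]] := odd_square_zero (tau_par parity_yxy) tyxy0; rewrite rho_yxy.
  rewrite sigmaM sigma_x_mu -scalerAl scalerAr rhoM rhoX.
  have [_ -> _] := modelX_mul w (rho (mu *: sigma (psi v))).
  rewrite mxE /= -j0 => /j_inj/eqP.
  by rewrite eq_sym polyC_eq0 (negPf nzX).
rewrite !sigmaM sigma_x_mu -(scalerAr mu) -!(scalerAl mu) scalerAr !rhoM rho_sy rhoX.
rewrite antidiag_modelX_antidiag.
have [f ->] := j_surj (rho (mu *: sigma (psi v)) 0 0).
rewrite mxE /= -!mulrA (jM _ f) (jM 'X%:P) => /(j_const nzX)[a [b [ra Xb ab]]].
have nz_b : b != 0 by apply: contraNneq nzX => b0; rewrite -ab b0 mulr0.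
have [c [d [/polyC_inj cX _ cdb]]] := skew_mul_const nz_b Xb.
have [nu nz_nu aE] : exists2 nu, nu != 0 & a = nu%:P.
  apply: (@poly_unit_const _ _ d); apply: (mulfI nzX).
  by rewrite mulrCA mulr1 [in X in _ * X]cX cdb ab.
by exists nu, q; rewrite sy ra aE.
Qed.

Variables (nu : k) (q : {poly {poly k}}).
Hypotheses (nz_nu : nu != 0) (sigma_yE : sigma y = nf 0 nu%:P%:P q 0).
Let b : {poly {poly k}} := nu%:P *: 'X + 'X *: q.

Lemma rho_image_y : rho (sigma y) = mx2 0 (j b) (j nu%:P%:P) 0.
Proof. by rewrite sigma_yE rho_nf scaler0 addr0 j0 mul_polyC. Qed.

Lemma rho_image_zpol c : exists e, rho (sigma (zpol c)) = mx2 (j e%:P) 0 0 (j e%:P).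
Proof.
elim/poly_ind: c => [|c a [e IH]]; first by exists 0; rewrite !raddf0 j0 mx2_0.
exists (e * (mu * nu)%:P * 'X + a%:P).
rewrite horner_algMXaddC sigmaD sigmaM sigmaZ rmorph1 rhoD rhoM rhoZ rmorph1 mulr1 IH.
have -> : rho (sigma z) = mx2 (j ((mu * nu)%:P * 'X)%:P) 0 0 (j ((mu * nu)%:P * 'X)%:P).
  rewrite zE sigmaD !sigmaM sigma_x_mu -scalerAl -scalerAr -scalerDr rhoZ rhoD !rhoM.
  rewrite rhoX rho_image_y antidiag_Z mx2_scalar_diag !jCM.
  have e1 : mu%:P * ('X * nu%:P) = (mu * nu)%:P * 'X by rewrite polyCM -mulrA (mulrC 'X).
  have e2 : mu%:P * (nu%:P * 'X) = (mu * nu)%:P * 'X by rewrite polyCM mulrA.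
  by rewrite !scale_polyC e1 e2.
by rewrite model_mx2C jCM -jD scale_polyC -polyCD mulrA.
Qed.

(** The lower right entry of sigma (psi p' * y ^+ 2 + a(z) + x ...) is
f * (nu b) plus a polynomial in w.  It must equal t for the preimage of
y ^+ 2, and degrees in t then bound the degree of b.  Comparing the relation
with z alone would not suffice in positive characteristic, where the
centralizer of w in J is larger than k[w]. *)
Lemma image_y_degree : (size q <= 2)%N.
Proof.
have even_yy : parity false (tau (y ^+ 2)).
  by apply: tau_par; rewrite /parity rmorphXn /= rhoY modelYY /mx2_parity !mxE.
have [p [s tyy]] := even_normal_form even_yy.
have : rho (sigma (tau (y ^+ 2))) 1 1 = t.
  by rewrite tauK (rmorphXn rho) rhoY modelYY mxE.
have {tyy} -> : tau (y ^+ 2) = psi p + x * (psi s * y).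
  by rewrite tyy normal_form_even.
(* Only the last coefficient of p is split off; the image of psi p stays
   arbitrary. *)
elim/poly_ind: p => [|p a _].
  rewrite sjpPsi0 add0r sigmaM sigma_x_mu -scalerAl scalerAr rhoM rhoX.
  have [_ _ ->] := modelX_mul w (rho (mu *: sigma (psi s * y))).
  by rewrite -j0 => /j_inj/eqP; rewrite eq_sym polyX_eq0.
rewrite sjpPsiMXaddC 2!sigmaD 2!sigmaM sigma_x_mu -scalerAl scalerAr.
have addE (M N : 'M[J]_2) : (M + N) 1 1 = M 1 1 + N 1 1 by rewrite mxE.
rewrite !rhoD (rhoM x) rhoX !addE.
have [_ _ ->] := modelX_mul w (rho (mu *: sigma (psi s * y))).
rewrite addr0 rmorphXn rhoM (rmorphXn rho) rho_image_y expr2 antidiag_sqr mul_diag_11.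
have [f ->] := j_surj (rho (sigma (psi p)) 1 1).
have [e ->] := rho_image_zpol a.
rewrite mxE /= jCM jM -jD => /j_inj/esym/eqP; rewrite -subr_eq => /eqP/esym fB.
have nz_fB : skew_mul (wder k) f (nu%:P *: b) != 0 by rewrite fB polyXsubC_eq0.
have nz_f : f != 0 by apply: contraNneq nz_fB => ->; rewrite skew_mul0l.
have nz_B : nu%:P *: b != 0 by apply: contraNneq nz_fB => ->; rewrite skew_mul0r.
have := size_skew_mul (wder k) nz_f nz_B.
rewrite fB size_XsubC size_scale ?polyC_eq0 // => sz_fb.
have sz_b : (size b <= 2)%N.
  move: sz_fb; case: (size f) (size_poly_gt0 f) => [|n _]; first by rewrite nz_f.
  rewrite addSn => sz_fb; rewrite [X in (_ <= X)%N](sz_fb : 2%N = _).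
  exact: leq_addl.
suff : (size ('X *: q) <= 2)%N by rewrite size_scale ?polyX_eq0.
have -> : 'X *: q = b - nu%:P *: 'X by rewrite /b addrC addKr.
apply: leq_trans (size_polyD _ _) _; rewrite geq_max sz_b size_polyN.
by rewrite (leq_trans (size_scale_leq _ _)) ?size_polyX.
Qed.

(** With b = b1(w) t + b0(w) and c = nu, the relation
y z = z y + x z becomes b1 = mu; since b1 = nu + w q1, this gives q1 = 0 and
nu = mu. *)
Lemma image_y_form : exists s, sigma y = mu *: y + zpol s * x.
Proof.
have qE : q = (q`_1)%:P * 'X + (q`_0)%:P.
  apply/polyP => -[|[|i]]; rewrite coefD coefMX !coefC ?add0r ?addr0 //.
  by rewrite nth_default // (leq_trans image_y_degree).
have bE : b = (q`_1 * 'X + nu%:P)%:P * 'X + ('X * q`_0)%:P.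
  rewrite /b {1}qE scalerDr scalerAl !scale_polyC addrA -mul_polyC -mulrDl.
  by rewrite -polyCD (addrC nu%:P) (mulrC 'X q`_1).
pose g := (nu * mu)%:P * 'X : {poly k}.
have rho_sx : rho (sigma x) = mx2 0 (j (mu%:P * 'X)%:P) 0 0.
  by rewrite sigma_x_mu rhoZ rhoX /modelX mx2M !(mul0r, mulr0, addr0) jCM scale_polyC.
have /(congr1 rho) : sigma (y * z - z * y - x * z) = 0 by rewrite relYZ raddf0.
rewrite zE !(rmorphB sigma) !sigmaM sigmaD !sigmaM !(rmorphB rho) !rhoM rhoD !rhoM raddf0.
rewrite rho_sx rho_image_y => /antidiag_relYZ.
rewrite !jCM !scale_polyC jM jCM.
move/eqP; rewrite subr_eq0 subr_eq -jD => /eqP/j_inj.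
have dg : wder k g = 'X * g.
  by rewrite /= /wder_fun derivM derivC derivX mul0r add0r mulr1 expr2 -mulrA
    (mulrC 'X (nu * mu)%:P).
have gE : nu%:P * (mu%:P * 'X) = g by rewrite /g polyCM mulrA.
rewrite -(mulrC nu%:P) gE bE skew_mulMXaddC !skew_mulCl skewTC dg.
(* Constant terms in t suffice: there b w - w b contributes b1 w^2. *)
move/(congr1 (fun f : {poly {poly k}} => f`_0)).
rewrite !(coefD, coefZ, coefMX, coefX, coefC) /= !mulr0 !add0r (mulrC g) => /addIr.
have nz_g : g != 0 by rewrite mulf_neq0 ?polyX_eq0 ?polyC_eq0 ?mulf_neq0.
rewrite mulrA => /(mulIf nz_g)/(mulIf (negbT (polyX_eq0 k))).
rewrite -[RHS]add0r -[X in X + mu%:P](mul0r 'X) => /polyMXaddC_inj[q1 nu_mu].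
exists q`_0; rewrite sigma_yE normal_form_odd {1}qE q1 mul0r add0r nu_mu !sjpPsiC.
rewrite horner_algC mulr_algl -zE.
by rewrite (x_zpol zE relXX).
Qed.

End Automorphism.

Lemma automorphism_form (sigma tau : {rmorphism A -> A}) :
    (forall c u, sigma (c *: u) = c *: sigma u) ->
    (forall u, sigma (tau u) = u) -> (forall u, tau (sigma u) = u) ->
    (forall i u, parity i u -> parity i (sigma u)) ->
    (forall i u, parity i u -> parity i (tau u)) ->
  exists mu s, [/\ mu != 0, sigma x = mu *: x & sigma y = mu *: y + zpol s * x].
Proof.
move=> sigmaZ tauK sigmaK sigma_par tau_par.
have [q sx] := image_x_multiple tauK sigma_par tau_par.
have [q' tx] := image_x_multiple sigmaK tau_par sigma_par.
have [mu nz_mu sx_mu] := image_x_scalar tauK sx tx.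
have [nu [r [nz_nu sy]]] := image_y_corner_scalar tauK sigma_par tau_par sx_mu.
have [s sy_mu] := image_y_form tauK tau_par sigmaZ nz_mu sx_mu nz_nu sy.
by exists mu, s.
Qed.

Lemma zpol_x_inj c d : zpol c * x = zpol d * x -> c = d.
Proof.
have rho_zpol_x a : rho (zpol a * x) = mx2 0 (j ('X *: a%:P)) 0 0.
  by rewrite -(x_zpol zE relXX) -(sjpPsiC y) rho_x_psi.
move=> /(congr1 rho); rewrite !rho_zpol_x => /mx2_inj[_ /j_inj/scaleX_inj/polyC_inj].
by [].
Qed.
End Representation.

(** * Composition of the substitutions *)

Section TwistMorphism.
Variables (k : fieldType) (A : algType k) (x y z : A).
Hypotheses (zE : z = x * y + y * x) (relXX : x ^+ 2 = 0)
  (relYZ : y * z - z * y - x * z = 0).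
Notation zpol := (horner_alg z).
Variables (phi : {rmorphism A -> A}) (mu : k) (s : {poly k}).
Hypotheses (phiZ : forall c u, phi (c *: u) = c *: phi u)
  (phi_x : phi x = mu *: x) (phi_y : phi y = mu *: y + zpol s * x).

Let phiM u v : phi (u * v) = phi u * phi v. Proof. exact: rmorphM. Qed.
Let phiD u v : phi (u + v) = phi u + phi v. Proof. exact: rmorphD. Qed.

Lemma twist_morph_z : phi z = mu ^+ 2 *: z.
Proof. by rewrite {1}zE phiD !phiM phi_x phi_y (twist_z zE relXX). Qed.

Lemma twist_morph_xy : phi (x * y) = mu ^+ 2 *: (x * y).
Proof. by rewrite phiM phi_x phi_y (twist_xy zE relXX). Qed.

Lemma twist_morph_yy : phi (y ^+ 2) = mu ^+ 2 *: y ^+ 2 + mu *: (z * zpol s).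
Proof. by rewrite expr2 phiM phi_y -expr2 (twist_yy zE relXX relYZ). Qed.

Let zpolD c d : zpol (c + d) = zpol c + zpol d. Proof. exact: rmorphD. Qed.
Let zpolZ c p : zpol (c *: p) = c *: zpol p. 
Proof. by rewrite -mul_polyC rmorphM /= horner_algC mulr_algl. Qed.

Lemma twist_morph_zpol c : phi (zpol c) = zpol (c \Po (mu ^+ 2 *: 'X)).
Proof.
elim/poly_ind: c => [|c a IH]; first by rewrite comp_poly0 !rmorph0.
rewrite comp_poly_MXaddC -scalerAr scalerAl horner_algMXaddC phiD phiM phiZ rmorph1.
rewrite IH twist_morph_z horner_algMXaddC -scalerAr; congr (_ + _).
by rewrite scalerAl zpolZ.
Qed.

Lemma twist_morph_comp nu t :
  phi (nu *: y + zpol t * x) =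
  (mu * nu) *: y + zpol (nu *: s + mu *: (t \Po (mu ^+ 2 *: 'X))) * x.
Proof.
rewrite phiD phiM phiZ twist_morph_zpol phi_x phi_y zpolD !zpolZ mulrDl.
by rewrite scalerDr -scalerAr -!scalerAl scalerA (mulrC nu) addrA.
Qed.

Lemma twist_morph_inv nu t :
    mu * nu = 1 -> nu *: s + mu *: (t \Po (mu ^+ 2 *: 'X)) = 0 ->
  phi (nu *: x) = x /\ phi (nu *: y + zpol t * x) = y.
Proof.
move=> munu st0; split; first by rewrite phiZ phi_x scalerA mulrC munu scale1r.
by rewrite twist_morph_comp munu st0 rmorph0 mul0r addr0 scale1r.
Qed.

End TwistMorphism.

(** The parameters of the inverse substitution, for both orders of
composition. *)
Lemma twist_inv_poly (k : fieldType) (mu : k) (s : {poly k}) (nu := mu^-1)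
    (t := - (nu ^+ 2 *: (s \Po (nu ^+ 2 *: 'X)))) : mu != 0 ->
  nu *: s + mu *: (t \Po (mu ^+ 2 *: 'X)) = 0 /\
  mu *: t + nu *: (s \Po (nu ^+ 2 *: 'X)) = 0.
Proof.
move=> nz_mu; have munu2 : mu * nu ^+ 2 = nu by rewrite expr2 mulrA mulfV ?mul1r.
have nuK : (nu ^+ 2 *: 'X) \Po (mu ^+ 2 *: 'X) = 'X :> {poly k}.
  by rewrite comp_polyZ comp_polyX scalerA -exprMn mulVf // expr1n scale1r.
split; rewrite /t; last by rewrite scalerN scalerA munu2 addNr.
rewrite -scaleN1r !comp_polyZ -comp_polyA nuK comp_polyXr scaleN1r scalerN scalerA.
by rewrite munu2 addrN.
Qed.

(** The hypothesis on endomorphisms says that x and y generate A. *)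
Lemma twist_cancel (k : fieldType) (A : algType k) (x y z : A)
    (zE : z = x * y + y * x) (relXX : x ^+ 2 = 0)
    (endo_eq : forall phi psi : {rmorphism A -> A},
       (forall c u, phi (c *: u) = c *: phi u) ->
       (forall c u, psi (c *: u) = c *: psi u) ->
       phi x = psi x -> phi y = psi y -> phi =1 psi)
    (mu nu : k) (s t : {poly k}) (phi psi : {rmorphism A -> A}) :
    mu * nu = 1 -> nu *: s + mu *: (t \Po (mu ^+ 2 *: 'X)) = 0 ->
    (forall c u, phi (c *: u) = c *: phi u) ->
    (forall c u, psi (c *: u) = c *: psi u) ->
    phi x = mu *: x -> phi y = mu *: y + horner_alg z s * x ->
    psi x = nu *: x -> psi y = nu *: y + horner_alg z t * x ->
  cancel psi phi.
Proof.
move=> munu st0 phiZ psiZ phi_x phi_y psi_x psi_y.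
have [phi_psix phi_psiy] := twist_morph_inv zE relXX phiZ phi_x phi_y munu st0.
apply: (endo_eq (phi \o psi) idfun) => [c u|||] //=.
- by rewrite psiZ phiZ.
- by rewrite psi_x.
- by rewrite psi_y.
Qed.

(** * The super-automorphism group *)

Section SigmaGroup.
Variable k : fieldType.
Notation B := (sjp k).
Notation x := (sjpX k).
Notation y := (sjpY k).
Notation z := (sjpZ k).
Notation zpol := (horner_alg z).
Notation J := (skewPoly (wder k)).

Let zE : z = x * y + y * x. Proof. exact: erefl. Qed.
Let relXX := sjp_relXX k.
Let relYZ := sjp_relYZ k.

Lemma sjp_representation : exists rho : {rmorphism B -> 'M[J]_2},
  [/\ rho x = modelX (jordanW k), rho y = modelY (jordanT k) &
      forall c u, rho (c *: u) = mx2 (c%:P%:P : J) 0 0 c%:P%:P * rho u].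
Proof.
have [rho [rhoX rhoY rhoZ]] := sjp_universal (@modelC_central k)
  (model_xx (jordanW k)) (model_yz (jordan_tw k)).
exists rho; split; [exact: rhoX | exact: rhoY |] => c u.
exact: etrans (rhoZ c u) (congr1 ( *%R^~ (rho u)) (modelCE c)).
Qed.

Lemma sjp_spanned (u : B) : has_normal_form x y z u.
Proof.
have nf_lin c v v' := @normal_form_lin k B x y z c v v'.
apply: (@sjp_word_ind k (has_normal_form x y z)).
  by split; [exact: normal_form0 | exact: nf_lin].
elim=> [|i l IHl]; rewrite /sjpWord ?big_nil ?big_cons; first exact: normal_form1.
case: i; first exact: (normal_form_muly zE relXX relYZ IHl).
exact: (normal_form_mulx relXX IHl).
Qed.

Lemma homogD i (u v : B) : sjpHomog i u -> sjpHomog i v -> sjpHomog i (u + v).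
Proof.
move=> ui vi; have [_ HL] := @sjpHomog_lin k i.
by rewrite -[u]scale1r; exact: HL 1 u v ui vi.
Qed.

Lemma homog_zpol c : @sjpHomog k false (zpol c).
Proof.
have [H0 HL] := @sjpHomog_lin k false.
have Hz : sjpHomog false z.
  exact: homogD (sjpHomogM (sjpHomogX k) (sjpHomogY k))
    (sjpHomogM (sjpHomogY k) (sjpHomogX k)).
elim/poly_ind: c => [|c a IH]; first by rewrite (rmorph0 (horner_alg z)).
rewrite horner_algMXaddC addrC.
exact: HL _ _ _ (sjpHomog1 k) (sjpHomogM IH Hz).
Qed.

Lemma homog_psi f : @sjpHomog k false (sjpPsi y z f).
Proof.
have [H0 _] := @sjpHomog_lin k false.
elim/poly_ind: f => [|f c IH]; first by rewrite sjpPsi0.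
rewrite sjpPsiMXaddC; apply: homogD (homog_zpol c).
exact: sjpHomogM IH (sjpHomogM (sjpHomogY k) (sjpHomogY k)).
Qed.

Section Rho.
Variable rho : {rmorphism B -> 'M[J]_2}.
Hypotheses (rhoX : rho x = modelX (jordanW k)) (rhoY : rho y = modelY (jordanT k))
  (rhoZ : forall c u, rho (c *: u) = mx2 (c%:P%:P : J) 0 0 c%:P%:P * rho u).

Let jD : {morph (fun f : {poly {poly k}} => f : J) : f g / f + g}.
Proof. by []. Qed.
Let jM (f g : {poly {poly k}}) : (f : J) * (g : J) = (skew_mul (wder k) f g : J).
Proof. exact: erefl. Qed.
Let j_inj : injective (fun f : {poly {poly k}} => f : J).
Proof. by []. Qed.
Let j_surj (a : J) : exists f : {poly {poly k}}, a = f.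
Proof. by exists a. Qed.

(** The grading is thus visible in the matrix model: even elements are the
diagonal ones, odd elements the antidiagonal ones. *)
Lemma homog_parity i u : sjpHomog i u <-> parity rho i u.
Proof.
split.
  apply: sjp_homog_ind => [|l <-].
    split=> [|c a b Pa Pb]; first by rewrite /parity raddf0; exact: mx2_parity0.
    rewrite /parity (rmorphD rho) rhoZ; exact: mx2_parity_lin.
  elim: l => [|b l IHl]; rewrite /sjpWord ?big_nil ?big_cons.
    by rewrite /parity rmorph1; exact: mx2_parity1.
  rewrite /parity (rmorphM rho); case: b; rewrite ?rhoX ?rhoY.
    exact: mx2_parity_modelY.
  exact: mx2_parity_modelX.
case: i => Pu.
  have [r [q ->]] := odd_normal_form zE sjp_spanned jD jM j_inj rhoX rhoY rhoZ Pu.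
  rewrite normal_form_odd; apply: homogD.
    exact: sjpHomogM (homog_psi r) (sjpHomogY k).
  exact: sjpHomogM (sjpHomogX k) (homog_psi q).
have [p [s ->]] := even_normal_form zE sjp_spanned jD jM j_inj rhoX rhoY rhoZ Pu.
rewrite normal_form_even; apply: homogD (homog_psi p) _.
exact: sjpHomogM (sjpHomogX k) (sjpHomogM (homog_psi s) (sjpHomogY k)).
Qed.

Lemma sjp_zpol_x_inj c d : zpol c * x = zpol d * x -> c = d.
Proof. exact: (zpol_x_inj zE relXX jD jM j_inj rhoX rhoY rhoZ). Qed.

Lemma superAut_homog (f : superAut k) i u : sjpHomog i u -> sjpHomog i (f u).
Proof.
by have [_ _ _ e] := superAutP f => Hu; rewrite -(e i); exists u.
Qed.

Lemma superAut_form (sigma : superAut k) :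
  exists (mu : fieldUnits k) (s : {poly k}), isSigma s mu sigma.
Proof.
pose tau := superAut_invg sigma.
have par (f : superAut k) i u : parity rho i u -> parity rho i (f u).
  by move=> /homog_parity Hu; apply/homog_parity/superAut_homog.
have [mu [s [nz_mu sx sy]]] := @automorphism_form k B x y z zE relXX relYZ sjp_spanned
  J _ jD jM j_inj j_surj rho rhoX rhoY rhoZ sigma tau (fun c u => linearZ _ _)
  (superAut_invK sigma) (superAutK sigma) (par sigma) (par tau).
by exists (exist _ mu nz_mu), s.
Qed.

End Rho.

Lemma twist_endo mu s : exists phi : {rmorphism B -> B},
  [/\ phi x = mu *: x, phi y = mu *: y + zpol s * x &
      forall c u, phi (c *: u) = c *: phi u].
Proof.
have iotaC (c : k) (u : B) : in_alg B c * u = u * in_alg B c.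
  exact: etrans (mulr_algl c u) (esym (mulr_algr c u)).
have yz := twist_yz zE relXX relYZ mu s.
rewrite -(twist_z zE relXX mu s) in yz.
have [phi [phi_x phi_y phiZ]] := sjp_universal iotaC (twist_xx relXX mu) yz.
exists phi; split; [exact: phi_x | exact: phi_y |] => c u.
exact: etrans (phiZ c u) (mulr_algl c _).
Qed.

Lemma endo_eq (phi psi : {rmorphism B -> B}) :
    (forall c u, phi (c *: u) = c *: phi u) ->
    (forall c u, psi (c *: u) = c *: psi u) ->
  phi x = psi x -> phi y = psi y -> phi =1 psi.
Proof.
move=> phiZ psiZ eqx eqy; apply: (@sjp_word_ind k (fun u => phi u = psi u)).
  split=> [|c u v eu ev]; first by rewrite !raddf0.
  by rewrite (rmorphD phi) (rmorphD psi) phiZ psiZ eu ev.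
elim=> [|i l IHl]; rewrite /sjpWord ?big_nil ?big_cons; first by rewrite !rmorph1.
by rewrite (rmorphM phi) (rmorphM psi) -/(sjpWord k l) IHl; case: i; rewrite ?eqx ?eqy.
Qed.

Lemma twist_endo_homog (phi : {rmorphism B -> B}) mu s :
    (forall c u, phi (c *: u) = c *: phi u) ->
    phi x = mu *: x -> phi y = mu *: y + zpol s * x ->
  forall i u, sjpHomog i u -> sjpHomog i (phi u).
Proof.
move=> phiZ phi_x phi_y i u.
have [H0 HL] := @sjpHomog_lin k i.
apply: (@sjp_homog_ind k i (fun v => @sjpHomog k i (phi v))) => [|l <-].
  split=> [|c v w Hv Hw]; first by rewrite raddf0.
  rewrite (rmorphD phi) phiZ; exact: HL.
elim: l => [|b l IHl]; rewrite /sjpWord ?big_nil ?big_cons.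
  by rewrite rmorph1; exact: sjpHomog1.
have [Hx0 HxL] := @sjpHomog_lin k true.
rewrite (rmorphM phi); apply: (@sjpHomogM k true) IHl.
case: b; rewrite ?phi_x ?phi_y.
  apply: HxL (sjpHomogY k) _; exact: sjpHomogM (homog_zpol s) (sjpHomogX k).
rewrite -[_ *: x]addr0; exact: HxL _ _ _ (sjpHomogX k) Hx0.
Qed.

Lemma sigma_exists mu s : mu != 0 -> exists sigma : superAut k, isSigma s mu sigma.
Proof.
move=> nz_mu.
have [phi [phi_x phi_y phiZ]] := twist_endo mu s.
pose nu := mu^-1; pose t := - (nu ^+ 2 *: (s \Po (nu ^+ 2 *: 'X))).
have [psi [psi_x psi_y psiZ]] := twist_endo nu t.
have [st0 ts0] := twist_inv_poly s nz_mu.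
have psiK := twist_cancel zE relXX endo_eq (mulfV nz_mu) st0
  phiZ psiZ phi_x phi_y psi_x psi_y.
have phiK := twist_cancel zE relXX endo_eq (mulVf nz_mu) ts0
  psiZ phiZ psi_x psi_y phi_x phi_y.
have phi_homog := twist_endo_homog phiZ phi_x phi_y.
have psi_homog := twist_endo_homog psiZ psi_x psi_y.
have phiP : isSuperAut phi.
  split.
  - by move=> c u v; rewrite (rmorphD phi) phiZ.
  - by split; [exact: rmorph1 | exact: rmorphM].
  - by exists psi.
  move=> i; apply/seteqP; split=> [_ [u Hu <-]|u Hu]; first exact: phi_homog.
  by exists (psi u); [exact: psi_homog | exact: psiK].
exists (SuperAut phiP); split; [exact: phi_x | exact: phi_y].
Qed.

Lemma superAut_sigma (sigma : superAut k) :
  exists (mu : fieldUnits k) (s : {poly k}), isSigma s mu sigma.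
Proof.
have [rho [rhoX rhoY rhoZ]] := sjp_representation.
exact: superAut_form rhoX rhoY rhoZ sigma.
Qed.

(** The parameters are unique: x is not a torsion element for k[z]. *)
Lemma isSigma_inj (s t : {poly k}) (mu nu : k) (f : superAut k) :
  isSigma s mu f -> isSigma t nu f -> s = t /\ mu = nu.
Proof.
have [rho [rhoX rhoY rhoZ]] := sjp_representation.
have zpol_inj := sjp_zpol_x_inj rhoX rhoY rhoZ.
have zpolC c : zpol c%:P * x = c *: x.
  by rewrite horner_algC; exact: mulr_algl.
move=> [fx fy] [fx' fy'].
have mu_nu : mu = nu.
  apply: polyC_inj; apply: zpol_inj.
  exact: etrans (zpolC mu) (etrans (esym fx) (etrans fx' (esym (zpolC nu)))).
split=> //; apply: zpol_inj; apply: (addrI (mu *: y)).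
rewrite {2}mu_nu; exact: etrans (esym fy) fy'.
Qed.

Lemma isSigma_mul (s t : {poly k}) (mu nu : k) (f g : superAut k) :
  isSigma s mu f -> isSigma t nu g ->
  isSigma (nu *: s + mu *: (t \Po (mu ^+ 2 *: 'X))) (mu * nu) (f * g)%g.
Proof.
move=> [fx fy] [gx gy]; have fZ c u : f (c *: u) = c *: f u by exact: linearZ.
split.
  apply: etrans (congr1 f gx) _; rewrite fZ fx.
  exact: etrans (scalerA _ _ _) (congr1 ( *:%R^~ x) (mulrC _ _)).
apply: etrans (congr1 f gy) _.
exact: (twist_morph_comp zE relXX fZ fx fy).
Qed.

Lemma isSigma_even (sigma : superAut k) (s : {poly k}) (mu : fieldUnits k) :
  isSigma s mu sigma ->
  [/\ sigma z = (mu : k) ^+ 2 *: z,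
      sigma (y ^+ 2) = (mu : k) ^+ 2 *: y ^+ 2 + (mu : k) *: (z * zpol s) &
      sigma (x * y) = (mu : k) ^+ 2 *: (x * y)].
Proof.
move=> [sx sy]; split.
- exact: (twist_morph_z zE relXX sx sy).
- exact: (twist_morph_yy zE relXX relYZ sy).
- exact: (twist_morph_xy zE relXX sx sy).
Qed.

End SigmaGroup.

Theorem theorem5p3 (k : fieldType) (char_k : 2%N \notin [pchar k]) :
  [/\ (forall sigma : superAut k,
         exists (mu : fieldUnits k) (s : {poly k}), isSigma s mu sigma),
      (exists phi : semidirect (dilation k) -> superAut k,
         [/\ {morph phi : u v / (u * v)%g >-> (u * v)%g},
             bijective phi,
             (forall (s : {poly k}) (mu : fieldUnits k),
                isSigma ((mu : k) *: s) mu (phi (s, mu))),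
             [set phi (s, 1%g) | s in [set: {poly k}]] =
               [set sigma | exists s : {poly k}, isSigma s 1 sigma] &
             [set phi (0, mu) | mu in [set: fieldUnits k]] =
               [set sigma | exists mu : fieldUnits k, isSigma 0 mu sigma]]) &
      (forall (sigma : superAut k) (s : {poly k}) (mu : fieldUnits k),
         isSigma s mu sigma ->
         [/\ sigma (sjpZ k) = (mu : k) ^+ 2 *: sjpZ k,
             sigma (sjpY k ^+ 2) =
               (mu : k) ^+ 2 *: sjpY k ^+ 2 +
               (mu : k) *: (sjpZ k * horner_alg (sjpZ k) s) &
             sigma (sjpX k * sjpY k) = (mu : k) ^+ 2 *: (sjpX k * sjpY k)])].
Proof.
split; [exact: superAut_sigma | | exact: isSigma_even].
pose phi (u : semidirect (dilation k)) : superAut k :=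
  sval (cid (sigma_exists (fieldUnits_val u.2 *: u.1) (valP u.2))).
have phiP u : isSigma (fieldUnits_val u.2 *: u.1) (fieldUnits_val u.2) (phi u).
  exact: svalP (cid _).
exists phi; split.
- move=> u v; apply: (isSigma_uniq (phiP (u * v)%g)).
  have -> : fieldUnits_val (u * v)%g.2 *: (u * v)%g.1 =
      fieldUnits_val v.2 *: (fieldUnits_val u.2 *: u.1)
      + fieldUnits_val u.2 *: ((fieldUnits_val v.2 *: v.1) \Po (fieldUnits_val u.2 ^+ 2 *: 'X)).
    rewrite comp_polyZ !scalerA [fieldUnits_val v.2 * _]mulrC -scalerDr; exact: erefl.
  exact: isSigma_mul (phiP u) (phiP v).
- exists (fun sigma => 
    let: exist mu muP := cid (superAut_sigma sigma) in
    let: exist s _ := cid muP in ((mu : k)^-1 *: s, mu)).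
    move=> [s mu] /=; case: cid => nu nuP; case: cid => t st.
    have [ts numu] := isSigma_inj st (phiP (s, mu)).
    have -> : nu = mu by exact: val_inj.
    by rewrite ts scalerA mulVf ?scale1r // (valP mu).
  move=> sigma; case: cid => nu nuP; case: cid => t st.
  apply: isSigma_uniq (phiP _) _ => /=.
  by rewrite scalerA mulfV ?scale1r // (valP nu).
- by move=> s mu; exact: phiP.
- apply/seteqP; split=> [_ [s _ <-]|sigma [s ss]] /=.
    by exists s; have := phiP (s, 1%g); rewrite scale1r.
  exists s => //; apply: isSigma_uniq ss; have := phiP (s, 1%g).
  by rewrite scale1r.
apply/seteqP; split=> [_ [mu _ <-]|sigma [mu smu]] /=.
  by exists mu; have := phiP (0, mu); rewrite scaler0.
exists mu => //; apply: isSigma_uniq smu; have := phiP (0, mu).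
by rewrite scaler0.
Qed.
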